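(* Let $\mathcal{F}$ be a countable class of measurable real-valued functions on a measurable space $\mathcal{X}$, let $X_1,\dots,X_n$ be independent $\mathcal{X}$-valued random variables, let $Z$ be the conditional Rademacher average $$Z=\mathbb{E}\Bigl[\sup_{f\in\mathcal{F}}\Bigl|\sum_{i=1}^n\varepsilon_if(X_i)\Bigr|\,\Big|\,X_1,\dots,X_n\Bigr],$$ and let $M=\sup_{1\le i\le n,\,f\in\mathcal{F}}|f(X_i)|$. Then there is an absolute constant $C_2<2.42$ such that for all real $q\ge2$, $$\|(Z-\mathbb{E}[Z])_+\|_q\le\sqrt{2\kappa q\,\|M\|_q\,\mathbb{E}[Z]}+\kappa q\,\|M\|_q$$ and $$\|(Z-\mathbb{E}[Z])_-\|_q\le\sqrt{2C_2}\,\Bigl\{\sqrt{q\,\|M\|_q\,\mathbb{E}[Z]}+2q\,\|M\|_q\Bigr\} .$$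
   Context: $\varepsilon_1,\dots,\varepsilon_n$ are i.i.d. Rademacher random variables (uniform on $\{-1,1\}$), independent of $X_1,\dots,X_n$. $x_+=\max(x,0)$, $x_-=\max(-x,0)$, $\|Y\|_q=(\mathbb{E}|Y|^q)^{1/q}$, $\kappa=\frac{\sqrt e}{2(\sqrt e-1)}<1.271$. ''Absolute'' means not depending on $n$, $q$, $\mathcal{F}$ or the distributions. Each inequality is understood as trivially true when its right-hand side is infinite. *)

(* Defs.v *)
From HB Require Import structures.
From mathcomp Require Import all_boot all_order all_algebra.
From mathcomp Require Import all_classical all_reals all_analysis measurable_realfun.

Set Implicit Arguments.
Unset Strict Implicit.
Unset Printing Implicit Defensive.

Import Order.TTheory GRing.Theory Num.Theory.
Import numFieldNormedType.Exports.

Local Open Scope classical_set_scope.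
Local Open Scope ring_scope.

Definition kappa (R : realType) : R :=
  Num.sqrt (expR 1) / (2 * (Num.sqrt (expR 1) - 1)).

(* Mutual independence of a finite family of set systems: the product rule
   over every subfamily. *)
Definition independent_family d (T : measurableType d) (R : realType)
    (P : probability T R) (I : finType) (G : I -> set (set T)) : Prop :=
  forall (J : {set I}) (A : I -> set T),
    (forall i, i \in J -> G i (A i)) ->
    P (\bigcap_(i in [set` J]) A i) = (\prod_(i in J) P (A i))%E.

Definition independent_pair d (T : measurableType d) (R : realType)
    (P : probability T R) (G H : set (set T)) : Prop :=
  forall A B : set T, G A -> H B -> P (A `&` B) = (P A * P B)%E.

Definition independent_RVs d d' (T : measurableType d) (T' : measurableType d')
    (R : realType) (P : probability T R) (n : nat)
    (X : 'I_n -> {RV P >-> T'}) : Prop :=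
  independent_family P (fun i => g_sigma_algebra_preimage (X i)).

Definition sigma_RVs d d' (T : measurableType d) (T' : measurableType d')
    (R : realType) (P : probability T R) (n : nat)
    (X : 'I_n -> {RV P >-> T'}) : set (set T) :=
  g_sigma_preimage (fun i => X i : T -> T').

Definition rademacher d (T : measurableType d) (R : realType)
    (P : probability T R) (e : {RV P >-> R}) : Prop :=
  P (e @^-1` [set 1]) = (2^-1)%:E /\ P (e @^-1` [set -1]) = (2^-1)%:E.

(* Z is a version of the conditional expectation of S given the sub-sigma-algebra
   G. Intended for nonnegative measurable S, integrable or not: then such a Z
   exists, with values in [0, +oo] almost surely, and is unique almost surely. *)
Definition is_cond_expectation d (T : measurableType d) (R : realType)
    (P : probability T R) (G : set (set T)) (S Z : T -> \bar R) : Prop :=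
  (forall B : set (\bar R), measurable B -> G (Z @^-1` B)) /\
  (forall A : set T, G A -> (\int[P]_(w in A) Z w = \int[P]_(w in A) S w)%E).

(* ereal_sup set0 = -oo: for empty F or n = 0 the envelope below is -oo, its
   L^q norm is +oo, and an upper bound in terms of that norm says nothing. *)
Definition rademacher_sup (T U : Type) (R : realType) (n : nat)
    (F : set (U -> R)) (eps : 'I_n -> T -> R) (X : 'I_n -> T -> U) (w : T)
    : \bar R :=
  ereal_sup [set `|\sum_(i < n) eps i w * f (X i w)|%:E | f in F].

Definition envelope (T U : Type) (R : realType) (n : nat)
    (F : set (U -> R)) (X : 'I_n -> T -> U) (w : T) : \bar R :=
  ereal_sup [set `|f (X i w)|%:E | i in [set: 'I_n] & f in F].

(* Main.v *)
Require Import Defs.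
From HB Require Import structures.
From mathcomp Require Import all_boot all_order all_algebra.
From mathcomp Require Import all_classical all_reals all_analysis measurable_realfun.
From mathcomp Require Import ring lra.

(** Both inequalities come from the fact that the conditional Rademacher
average is a self-bounding function of X_1, ..., X_n.  Let Z be the average,
over all sign vectors, of the supremum over the class of the absolute signed
sums, and let Z_k be the same average with the k-th summand dropped.  Then
Z_k does not depend on X_k, 0 <= Z - Z_k <= M, and the differences Z - Z_k
add up to at most Z ([rad_avg_drop_le], [rad_avg_drop_ge],
[rad_avg_drop_sum]).  Nothing else about Z enters the moment bounds.

For q = p + 1 >= 2 and a nonnegative function x on a product space, the
difference E[x^q] - E[x^p]^(q/p) is subadditive over the coordinates
([breg_tensorization]).  The reason is that such a difference, taken in one
coordinate, is the minimum over constants u of the expected Bregman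
divergence of z |-> z^(q/p) between x^p and u ([average_ediv_const]), and
that this divergence is jointly convex ([ediv_jensen]); joint convexity
amounts to an inequality between two real numbers ([four_point]).  Testing
against functions of Z_k, which are constant in the k-th coordinate,
and using the self-bounding property gives, with x = (Z - E[Z])_+ and
y = (Z - E[Z])_-,

  E[x^q] <= E[x^(q-1)]^(q/(q-1)) + (q/2) E[M Z x^(q-2)],
  E[y^q] <= E[y^(q-1)]^(q/(q-1)) + q E[M (E[Z] + M) (y + M)^(q-2)]

([up_recursion], [dn_recursion]).  Hoelder's inequality turns the last terms
into norms, and an induction on q by unit steps, started on [2, 3) from the
variance bound, controls the norms themselves.  In the induction step the
factor (1 - 1/q)^(q/2) is at most e^(-1/2) = 1 - 1/(2 kappa), which is where
kappa comes from.  The upper tail satisfies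
||x||_q^2 <= kappa q ||M||_q (E[Z] + ||x||_q), and solving this quadratic
inequality gives [up_moment].  The lower tail satisfies
||y||_q <= 2 (sqrt(q ||M||_q E[Z]) + 2 q ||M||_q) ([dn_moment]), which is
the claim for C_2 = 2, as sqrt(2 C_2) = 2.

These arguments are carried out for independent variables with finitely many
values, where expectations are finite sums.  In general, the values f(X_i) of
the first m functions of the class are rounded towards 0 to multiples of 1/m
and capped at m.  The resulting average depends on independent
variables with finitely many values and its envelope is at most M, so both
moment bounds hold for it ([quant_upper_moment], [quant_lower_moment]).  As m
grows these averages converge wherever M is finite ([quant_rad_cvg]) and stay
below n M, so the bounds survive in the limit ([upper_moment_limit],
[lower_moment_limit]).

It remains to identify Z.  The signs are independent of X_1, ..., X_n and
uniform, so integrating the supremum over an event of sigma(X_1, ..., X_n)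
amounts to averaging over the sign vectors first ([integral_cond_rad]); by
uniqueness of conditional expectations ([sub_sigma_ae_eq]) every version
of Z is almost surely the average over sign vectors.  When ||M||_q is
infinite both right-hand sides are infinite, and this covers the empty class
and the case n = 0. *)

Set Implicit Arguments.
Unset Strict Implicit.
Unset Printing Implicit Defensive.

Import Order.TTheory GRing.Theory Num.Theory.
Import numFieldNormedType.Exports.

Local Open Scope classical_set_scope.
Local Open Scope ring_scope.

(** * Inequalities for real powers *)

Section power_inequalities.
Context {R : realType}.
Implicit Types (p s t x y u w : R).

Lemma mean_value_closed (f df : R -> R) (a b : R) : a <= b ->
  (forall x, a <= x <= b -> is_derive x 1 f (df x)) ->
  exists2 c, a <= c <= b & f b - f a = df c * (b - a).
Proof.
move=> ab fD; have fc : {within `[a, b], continuous f}.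
  apply: derivable_within_continuous => x; rewrite in_itv /= => /fD.
  by case.
have fD' x : x \in `]a, b[ -> is_derive x 1 f (df x).
  by move=> /subset_itv_oo_cc; rewrite in_itv; exact: fD.
have [c] := MVT_segment ab fD' fc.
by rewrite in_itv /= => cab e; exists c.
Qed.

Lemma powRS p x : 0 <= x -> 0 <= p -> x `^ (p + 1) = x * x `^ p.
Proof.
move=> x0 p0; rewrite -{2}[p](addrK 1) mulr_powRB1//.
by rewrite ltr_wpDl.
Qed.

Lemma powR_rootK p x : 0 <= x -> p != 0 -> (x `^ p^-1) `^ p = x.
Proof. by move=> x0 p0; rewrite -powRrM mulVf// powRr1. Qed.

Lemma root_powRK p x : 0 <= x -> p != 0 -> (x `^ p) `^ p^-1 = x.
Proof. by move=> x0 p0; rewrite -powRrM mulfV// powRr1. Qed.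

(** Young's inequality with the conjugate exponents (p + 1) / p and p + 1,
multiplied by p + 1; the slack is the divergence [breg] below. *)
Lemma young_powR p x w : 0 < p -> 0 <= x -> 0 <= w ->
  (p + 1) * (x `^ p * w) <= p * x `^ (p + 1) + w `^ (p + 1).
Proof.
move=> p0 x0 w0.
have p1 : 0 < p + 1 by rewrite addr_gt0.
have := @conjugate_powR R (x `^ p) w ((p + 1) / p) (p + 1) (powR_ge0 _ _) w0.
rewrite divr_gt0// p1 => /(_ isT isT) H.
have /H {}H : ((p + 1) / p)^-1 + (p + 1)^-1 = 1.
  by field; rewrite !gt_eqF.
rewrite -powRrM mulrCA divff ?gt_eqF// mulr1 in H.
rewrite -(ler_pM2l p1) in H; apply: (le_trans H).
by rewrite le_eqVlt; apply/orP; left; apply/eqP; field; rewrite !gt_eqF.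
Qed.

(** Young's inequality for the exponents p / (p - 1) and p with one factor
equal to 1. *)
Lemma bernoulli_powR p t : 1 <= p -> 0 <= t -> 1 + p * (t - 1) <= t `^ p.
Proof.
rewrite le_eqVlt => /predU1P[<- t0|p1 t0].
  by rewrite powRr1//; lra.
have p0 : 0 < p - 1 by rewrite subr_gt0.
have := young_powR p0 ler01 t0.
rewrite subrK !powR1 mul1r => H; lra.
Qed.

Lemma powR_ge_tangent p x y : 1 <= p -> 0 <= x -> 0 <= y ->
  x `^ p - y `^ p <= p * x `^ (p - 1) * (x - y).
Proof.
rewrite le_eqVlt => /predU1P[<- x0 y0|p1 x0 y0].
  rewrite subrr !powRr1//.
  have [->|xn0] := eqVneq x 0; first by rewrite powRr0; lra.
  by rewrite powRr0; lra.
have p0 : 0 < p - 1 by rewrite subr_gt0.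
have := young_powR p0 x0 y0; rewrite subrK.
have := powRS x0 (ltW p0); rewrite subrK => ->; nra.
Qed.

(** As a function of y, the right-hand side minus the left-hand side vanishes
at 1, and its derivative is nonpositive on [y, 1] because it is p + 1 times
the slack of [bernoulli_powR] with the sign reversed. *)
Lemma taylor2_powR p y : 1 <= p -> 0 <= y <= 1 ->
  y `^ (p + 1) <= 1 - (p + 1) * (1 - y) + (p + 1) * p / 2 * (1 - y) ^+ 2.
Proof.
move=> p1 /andP[]; rewrite le_eqVlt => /predU1P[<- _|y0 y1].
  rewrite powR0; last by rewrite gt_eqF//; lra.
  nra.
pose f z : R := (p + 1) * p / 2 * (1 - z) ^+ 2 - (p + 1) * (1 - z) - z `^ (p + 1).
pose df z : R := (p + 1) * (1 - p * (1 - z) - z `^ p).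
have [x xy|c cy e] := @mean_value_closed f df y 1 y1.
  have Dp := @is_derive1_powR _ (p + 1) x (lt_le_trans y0 (proj1 (andP xy))).
  have Dq : is_derive x 1 (fun z => (p + 1) * p / 2 * (1 - z) ^+ 2 -
      (p + 1) * (1 - z)) ((p + 1) * (1 - p * (1 - x))).
    apply: is_derive_eq; rewrite /GRing.scale /=; lra.
  have := is_deriveB Dq Dp; rewrite addrK => D.
  apply: (is_derive_eq D); rewrite /df; lra.
have : df c <= 0.
  rewrite /df; have c0 : 0 <= c by lra.
  have := bernoulli_powR p1 c0; nra.
move=> dc; have : f 1 - f y <= 0 by rewrite e mulr_le0_ge0// subr_ge0.
by rewrite /f powR1; lra.
Qed.

Lemma powR_le_conv p c u v : 1 <= p -> 0 <= c <= 1 -> 0 <= u -> 0 <= v ->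
  ((1 - c) * u + c * v) `^ p <= (1 - c) * u `^ p + c * v `^ p.
Proof.
move=> p1 /andP[c0 c1] u0 v0; set t := (1 - c) * u + c * v.
have c1' : 0 <= 1 - c by rewrite subr_ge0.
have t0 : 0 <= t by rewrite /t addr_ge0 ?mulr_ge0.
have := powR_ge_tangent p1 t0 v0; have := powR_ge_tangent p1 t0 u0.
set a := p * _; set b := t `^ p; set d := v `^ p; set e := u `^ p => H1 H2.
have {}H1 : (1 - c) * (b - e) <= (1 - c) * (a * (t - u)) by rewrite ler_wpM2l.
have {}H2 : c * (b - d) <= c * (a * (t - v)) by rewrite ler_wpM2l.
have : (1 - c) * (a * (t - u)) + c * (a * (t - v)) = 0 by rewrite /t; ring.
lra.
Qed.

Lemma convex_powR01 p c v : 1 <= p -> 0 <= c <= 1 -> 0 <= v ->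
  (1 - c + c * v) `^ p <= 1 - c + c * v `^ p.
Proof.
by move=> p1 c01 v0; have := powR_le_conv p1 c01 ler01 v0; rewrite powR1 !mulr1.
Qed.

(** Fix t and consider the right-hand side minus the left-hand side as a
function of s.  It vanishes at s = 1, and its derivative has the sign of s - 1
by convexity of the power: for s < 1 the number t is a convex combination of
1 and (s + t - 1) / s, and for s > 1 the number (s + t - 1) / s is a convex
combination of 1 and t. *)
Lemma four_point_pos p s t : 1 <= p -> 0 < s -> 0 < t -> 0 < s + t - 1 ->
  p + p * (s + t - 1) `^ (p + 1) <=
  p * s `^ (p + 1) + p * t `^ (p + 1) + (p + 1) * ((s `^ p - 1) * (t `^ p - 1)).
Proof.
move=> p1 s0 t0 w0.
pose f z : R := p * (z `^ (p + 1) - (z + (t - 1)) `^ (p + 1)) +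
  (p + 1) * (t `^ p - 1) * z `^ p.
pose df z : R := p * (p + 1) *
  (z `^ p - (z + (t - 1)) `^ p + z `^ (p - 1) * (t `^ p - 1)).
have fD z : 0 < z -> 0 < z + (t - 1) -> is_derive z 1 f (df z).
  move=> z0 wz0.
  have D1 := @is_derive1_powR _ (p + 1) z z0.
  have D2 := @is_derive1_powR _ (p + 1) _ wz0.
  have D3 := @is_derive1_powR _ p z z0.
  have D4 : is_derive z 1 (fun z => z + (t - 1)) 1.
    by apply: is_derive_eq; rewrite addr0.
  have D5 := @is_derive1_comp _ (fun z => z `^ (p + 1)) (fun z => z + (t - 1)) z _ _ D2 D4.
  have D6 := is_deriveZ p (is_deriveB D1 D5).
  have D7 := is_deriveD D6 (is_deriveZ ((p + 1) * (t `^ p - 1)) D3).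
  apply: (is_derive_eq D7).
  by rewrite addrK /df /GRing.scale /=; ring.
suff : f 1 <= f s.
  rewrite /f !powR1 (_ : 1 + (t - 1) = t); last by ring.
  rewrite (_ : s + (t - 1) = s + t - 1); last by ring.
  lra.
have pp : 0 <= p * (p + 1) by rewrite mulr_ge0//; lra.
have cp (c : R) : 0 < c -> c `^ p = c * c `^ (p - 1).
  by move=> c0; rewrite mulr_powRB1//; lra.
have [s1|s1] := leP s 1.
  have [c /andP[sc c1] e] := mean_value_closed s1 (fun z zs =>
      fD z ltac:(move/andP: zs; lra) ltac:(move/andP: zs; lra)).
  suff : df c * (1 - s) <= 0 by lra.
  have c0 : 0 < c by lra.
  rewrite mulr_le0_ge0 ?subr_ge0// mulr_ge0_le0//.
  set w := c + (t - 1).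
  have w_ge0 : 0 <= w by rewrite /w; lra.
  have c01 : 0 <= c <= 1 by lra.
  have := convex_powR01 p1 c01 (divr_ge0 w_ge0 (ltW c0)).
  have -> : 1 - c + c * (w / c) = t by rewrite /w; field; rewrite gt_eqF.
  move=> H.
  have -> : w `^ p = c `^ p * (w / c) `^ p.
    by rewrite -powRM ?divr_ge0 ?(ltW c0)// mulrC divfK ?gt_eqF.
  rewrite cp//.
  have : c `^ (p - 1) * t `^ p <= c `^ (p - 1) * (1 - c + c * (w / c) `^ p).
    by rewrite ler_wpM2l ?powR_ge0.
  lra.
have [c /andP[c1 sc] e] := mean_value_closed (ltW s1) (fun z zs =>
    fD z ltac:(move/andP: zs; lra) ltac:(move/andP: zs; lra)).
suff : 0 <= df c * (s - 1) by lra.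
have c0 : 0 < c by lra.
rewrite mulr_ge0 ?subr_ge0 ?(ltW s1)// mulr_ge0//.
set w := c + (t - 1).
have w_ge0 : 0 <= w by rewrite /w; lra.
have c01 : 0 <= c^-1 <= 1 by rewrite invr_ge0 ltW//= invf_le1.
have := convex_powR01 p1 c01 (ltW t0).
have -> : 1 - c^-1 + c^-1 * t = w / c by rewrite /w; field; rewrite gt_eqF.
move=> H.
have -> : w `^ p = c `^ p * (w / c) `^ p.
  by rewrite -powRM ?divr_ge0 ?(ltW c0)// mulrC divfK ?gt_eqF.
have : c `^ p * (w / c) `^ p <= c `^ p * (1 - c^-1 + c^-1 * t `^ p).
  by rewrite ler_wpM2l ?powR_ge0.
have -> : c `^ p * (1 - c^-1 + c^-1 * t `^ p) =
  c `^ p + c `^ (p - 1) * (t `^ p - 1).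
  by rewrite cp//; field; rewrite gt_eqF.
lra.
Qed.

(** The boundary case t = 0, which differentiation in [four_point_pos]
excludes. *)
Lemma four_point0 p s : 1 <= p -> 1 < s ->
  p + p * (s - 1) `^ (p + 1) <= p * s `^ (p + 1) - (p + 1) * (s `^ p - 1).
Proof.
move=> p1 s1; set w := s - 1.
have p0 : 0 < p by lra.
have w0 : 0 < w by rewrite subr_gt0.
have s0 : 0 < s by lra.
rewrite (powRS (ltW w0) (ltW p0)) (powRS (ltW s0) (ltW p0)).
have H1 : s `^ p - 1 <= p * s `^ (p - 1) * w.
  by have := powR_ge_tangent p1 (ltW s0) ler01; rewrite powR1.
have H2 : w `^ p <= s `^ (p - 1) * w.
  rewrite -(mulr_powRB1 (ltW w0) p0) mulrC ler_wpM2r ?(ltW w0)//.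
  have ws : w <= s by rewrite /w; lra.
  by apply: ge0_ler_powR; rewrite ?nnegrE; lra.
have H3 : s `^ p = s * s `^ (p - 1) by rewrite mulr_powRB1// ltW.
have H4 : (p * w) * s `^ (p - 1) <= (p * w) * (s `^ p - w `^ p).
  rewrite ler_wpM2l ?(mulr_ge0 (ltW p0) (ltW w0))// H3; rewrite /w in H2 *; lra.
rewrite /w in H1 H4 *; lra.
Qed.

Lemma young_powR_max p x w : 0 < p -> 0 <= x ->
  (p + 1) * (x `^ p * w) <= p * x `^ (p + 1) + (Num.max w 0) `^ (p + 1).
Proof.
move=> p0 x0; have [w0|w0] := leP 0 w; first exact: young_powR.
apply: (@le_trans _ _ 0).
  by rewrite mulr_ge0_le0 ?mulr_ge0_le0 ?powR_ge0 ?(ltW w0)//; lra.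
by rewrite addr_ge0 ?powR_ge0// mulr_ge0 ?powR_ge0// ltW.
Qed.

(** The inequality behind joint convexity of the divergence.  When s + t <= 1
the left-hand side is just p; by Young's inequality the right-hand side is
smallest at s = 1 - t `^ p, and for 0 < t < 1 < p this point lies in the range
of [four_point_pos]. *)
Lemma four_point p s t : 1 <= p -> 0 <= s -> 0 <= t ->
  p + p * (Num.max (s + t - 1) 0) `^ (p + 1) <=
  p * s `^ (p + 1) + p * t `^ (p + 1) + (p + 1) * ((s `^ p - 1) * (t `^ p - 1)).
Proof.
move=> p1 s0 t0.
have p0 : 0 < p by lra.
have p10 : p + 1 != 0 by rewrite gt_eqF//; lra.
have [w0|w0] := ltP 0 (s + t - 1).
  move: s0; rewrite le_eqVlt => /predU1P[s0|s0].
    have t1 : 1 < t by lra.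
    have := four_point0 p1 t1; rewrite -s0 add0r !powR0 ?gt_eqF//; lra.
  move: t0; rewrite le_eqVlt => /predU1P[t0|t0]; last exact: four_point_pos.
  have s1 : 1 < s by lra.
  have := four_point0 p1 s1; rewrite -t0 addr0 !powR0 ?gt_eqF//; lra.
rewrite powR0// mulr0 addr0.
have [pe|pn1] := eqVneq p 1.
  subst p; rewrite !powRr1//.
  have sq (z : R) : 0 <= z -> z `^ (1 + 1) = z ^+ 2.
    by move=> z0; rewrite (_ : 1 + 1 = 2%:R) ?powR_mulrn// -natr1.
  rewrite !sq//.
  have : 0 <= (s + t - 1) ^+ 2 by exact: sqr_ge0.
  rewrite !expr2; lra.
have [->|tn1] := eqVneq t 1.
  by rewrite !powR1; have := mulr_ge0 (ltW p0) (powR_ge0 s (p + 1)); lra.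
have t_lt1 : t < 1 by rewrite lt_neqAle tn1/=; lra.
have tp1 : t `^ p <= t.
  move: t0; rewrite le_eqVlt => /predU1P[<-|t0]; first by rewrite powR0 ?gt_eqF.
  by apply: ge1r_powR => //; rewrite t0; lra.
have c0 : 0 <= 1 - t `^ p by lra.
have Y := young_powR p0 s0 c0.
move: (t0); rewrite le_eqVlt => /predU1P[t_eq0|tgt0].
  move: Y; rewrite -t_eq0 !powR0// ?gt_eqF// subr0 powR1 => Y; lra.
have tpt : t `^ p < t.
  have pm1 : 0 < p - 1 by rewrite subr_gt0 lt_neqAle eq_sym pn1.
  have : t `^ (p - 1) < 1 `^ (p - 1).
    by apply: gt0_ltr_powR => //; rewrite ?nnegrE//; lra.
  by rewrite powR1 => H; rewrite -(mulr_powRB1 t0 p0) gtr_pMr.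
have w_gt0 : 0 < 1 - t `^ p + t - 1 by lra.
have : 0 < 1 - t `^ p by lra.
move=> /four_point_pos => /(_ _ _ p1 tgt0 w_gt0).
set c := 1 - t `^ p in Y c0 w_gt0 *.
have : 0 <= p * (c + t - 1) `^ (p + 1) by rewrite mulr_ge0 ?powR_ge0// ltW.
have -> : t `^ p = 1 - c by rewrite /c; ring.
rewrite (powRS c0 (ltW p0)) => H1 H2.
move: Y; rewrite (powRS c0 (ltW p0)) => Y; lra.
Qed.

End power_inequalities.

(** * Bregman divergences of powers *)

(** The Bregman divergence of z |-> p z^((p + 1) / p) at the points x^p and
y^p. *)
HB.lock Definition breg {R : realType} (p x y : R) : R :=
  p * x `^ (p + 1) - (p + 1) * (x `^ p * y) + y `^ (p + 1).

Section bregman_divergence.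
Context {R : realType}.
Implicit Types (p s t x y u w : R).

Lemma bregE p x y :
  breg p x y = p * x `^ (p + 1) - (p + 1) * (x `^ p * y) + y `^ (p + 1).
Proof. by rewrite breg.unlock. Qed.

Lemma breg_ge0 p x y : 0 < p -> 0 <= x -> 0 <= y -> 0 <= breg p x y.
Proof. by move=> p0 x0 y0; have := young_powR p0 x0 y0; rewrite bregE; lra. Qed.

(** Taylor's expansion in y at x, which by homogeneity may be taken to be 1. *)
Lemma breg_le_sqr p x y : 1 <= p -> 0 <= y <= x ->
  breg p x y <= (p + 1) * p / 2 * ((x - y) ^+ 2 * x `^ (p - 1)).
Proof.
move=> p1 /andP[y0 yx]; have p0 : 0 < p by lra.
have [x0|x0] := leP x 0.
  have -> : y = 0 by lra.
  have -> : x = 0 by lra.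
  rewrite subrr expr0n/= mul0r mulr0.
  by rewrite bregE !powR0 ?gt_eqF ?addr_gt0// !(mul0r, mulr0, subr0, addr0).
pose r := y / x.
have -> : y = x * r by rewrite /r mulrC divfK ?gt_eqF.
have r01 : 0 <= r <= 1 by rewrite /r divr_ge0 ?(ltW x0)//= ler_pdivrMr ?mul1r.
have r0 : 0 <= r by case/andP: r01.
have -> : (x - x * r) ^+ 2 * x `^ (p - 1) = x * x `^ p * (1 - r) ^+ 2.
  by rewrite -(mulr_powRB1 (ltW x0) p0); ring.
have := taylor2_powR p1 r01.
rewrite bregE powRM ?(ltW x0)// (powRS (ltW x0) (ltW p0)).
have : 0 <= x * x `^ p by rewrite mulr_ge0 ?powR_ge0 ?ltW.
set X := x * _; set Q := r `^ (p + 1) => X0 H.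
have : X * Q <= X * (1 - (p + 1) * (1 - r) + (p + 1) * p / 2 * (1 - r) ^+ 2).
  by rewrite ler_wpM2l.
have -> : x `^ p * (x * r) = X * r by rewrite /X; ring.
lra.
Qed.

(** Adding the divergence with exchanged arguments gives
(p + 1) (x - y) (x^p - y^p), to which the mean value bound applies. *)
Lemma breg_le_sqr_rev p x y : 1 <= p -> 0 <= x <= y ->
  breg p x y <= (p + 1) * p * ((x - y) ^+ 2 * y `^ (p - 1)).
Proof.
move=> p1 /andP[x0 xy]; have p0 : 0 < p by lra.
have y0 : 0 <= y := le_trans x0 xy.
have := breg_ge0 p0 y0 x0; rewrite !bregE !powRS ?(ltW p0)// => H.
have := powR_ge_tangent p1 y0 x0 => T.
have : (y - x) * (y `^ p - x `^ p) <= (y - x) * (p * y `^ (p - 1) * (y - x)).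
  by rewrite ler_wpM2l ?subr_ge0.
have -> : (y - x) * (p * y `^ (p - 1) * (y - x)) =
  p * ((x - y) ^+ 2 * y `^ (p - 1)) by ring.
move=> /(ler_wpM2l (ltW (addr_gt0 p0 ltr01))) {}T; lra.
Qed.

(** A supporting hyperplane of the divergence, written in the variables
x^p and y^p in which it is affine.  With w = x0 + y - y0, Young's inequality
bounds x^p w by p x^(p+1) + w_+^(p+1), and [four_point] at the ratios x0 / y0
and y / y0 bounds w_+^(p+1) by an affine function of y^p plus y^(p+1). *)
Lemma breg_ge_tangent p x0 y0 x y : 1 <= p -> 0 <= x0 -> 0 < y0 ->
  0 <= x -> 0 <= y ->
  p * ((p + 1) * (x0 - y0)) * x `^ p
    - (p + 1) * (x0 `^ p - y0 `^ p) * (y0 / y0 `^ p) * y `^ p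
    - breg p x0 y0 <= p * breg p x y.
Proof.
move=> p1 x00 y00 x_ge0 y_ge0; have p0 : 0 < p by lra.
have Yp : 0 < y0 `^ p by rewrite powR_gt0.
(* w pairs with x^p in Young's inequality; w / y0 = s + t - 1 in [four_point]. *)
pose w := x0 + y - y0.
have yi : 0 <= y0^-1 by rewrite invr_ge0 ltW.
have s0 : 0 <= x0 / y0 by rewrite mulr_ge0.
have t0 : 0 <= y / y0 by rewrite mulr_ge0.
have Yn : y0 != 0 by rewrite gt_eqF.
have p10 : 0 <= p + 1 by lra.
have sc z r : 0 <= z -> 0 <= r -> y0 `^ r * (z / y0) `^ r = z `^ r.
  move=> z0 r0; rewrite -powRM ?(ltW y00)// ?mulr_ge0//.
  by rewrite mulrC divfK.
have /(ler_wpM2l (powR_ge0 y0 (p + 1))) := four_point p1 s0 t0.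
have -> : Num.max (x0 / y0 + y / y0 - 1) 0 = Num.max w 0 / y0.
  rewrite maxr_pMl// mul0r; congr Num.max.
  by rewrite /w; field.
set M := (Num.max w 0 / y0) `^ _; set S := (x0 / y0) `^ _.
set T := (y / y0) `^ _; set A := y0 `^ _; set Q := _ * (_ - 1) => F.
have {F} : A * p + p * (A * M) <= p * (A * S) + p * (A * T) + A * ((p + 1) * Q).
  by lra.
rewrite /A /M /S /T /Q !sc ?le_max ?lexx ?orbT//.
have -> : y0 `^ (p + 1) * ((p + 1) * (((x0 / y0) `^ p - 1) * ((y / y0) `^ p - 1)))
   = (p + 1) * (x0 `^ p - y0 `^ p) * (y0 / y0 `^ p) * (y `^ p - y0 `^ p).
  rewrite -(sc x0 p)// ?(ltW p0)// -(sc y p)// ?(ltW p0)//.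
  rewrite (powRS (ltW y00) (ltW p0)); field; rewrite gt_eqF//.
have -> c : c * (y0 / y0 `^ p) * (y `^ p - y0 `^ p) = c * (y0 / y0 `^ p) * y `^ p - c * y0.
  by field; rewrite gt_eqF.
have /(ler_wpM2l (ltW p0)) := young_powR_max w p0 x_ge0.
rewrite !bregE (powRS (ltW y00) (ltW p0)) /w; lra.
Qed.

(** The divergence [breg] in the variables in which it is jointly convex. *)
Definition ediv p Y U : R := breg p (Y `^ p^-1) (U `^ p^-1).

Lemma ediv_powR p x y : 0 < p -> 0 <= x -> 0 <= y ->
  ediv p (x `^ p) (y `^ p) = breg p x y.
Proof. by move=> p0 x0 y0; rewrite /ediv !root_powRK// gt_eqF. Qed.

Lemma edivE p Y U : 0 < p -> 0 <= Y -> 0 <= U -> ediv p Y U =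
  p * (Y `^ p^-1) `^ (p + 1) - (p + 1) * (Y * U `^ p^-1) + (U `^ p^-1) `^ (p + 1).
Proof. by move=> p0 Y0 U0; rewrite /ediv bregE powR_rootK// gt_eqF. Qed.

Lemma ediv_ge0 p Y U : 0 < p -> 0 <= ediv p Y U.
Proof. by move=> p0; rewrite breg_ge0 ?powR_ge0. Qed.

Lemma ediv_self p Y : 0 < p -> 0 <= Y -> ediv p Y Y = 0.
Proof.
move=> p0 Y0; rewrite /ediv bregE powRS ?powR_ge0 ?(ltW p0)//; ring.
Qed.

Section weighted_average.
Context {I : finType} (w : I -> R).
Hypotheses (w0 : forall i, 0 <= w i) (w1 : \sum_i w i = 1).

Lemma average_ge0 (Y : I -> R) : (forall i, 0 <= Y i) -> 0 <= \sum_i w i * Y i.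
Proof. by move=> Y0; rewrite sumr_ge0// => i _; rewrite mulr_ge0. Qed.

Lemma average_affine (a b d : R) (A B : I -> R) :
  \sum_i w i * (a * A i + b * B i + d) =
  a * \sum_i w i * A i + b * \sum_i w i * B i + d.
Proof.
rewrite -[d in RHS]mul1r -w1 mulr_suml !mulr_sumr -!big_split /=.
by apply: eq_bigr => i _; ring.
Qed.

(** The averaged divergence to a constant U is smallest when U is the mean
of Y, and its minimum is p times the excess in Jensen's inequality for the
power (p + 1) / p. *)
Lemma average_ediv_const p (Y : I -> R) (U : R) : 0 < p ->
    (forall i, 0 <= Y i) -> 0 <= U ->
  \sum_i w i * ediv p (Y i) U =
  p * (\sum_i w i * (Y i `^ p^-1) `^ (p + 1)
       - ((\sum_i w i * Y i) `^ p^-1) `^ (p + 1)) + ediv p (\sum_i w i * Y i) U.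
Proof.
move=> p0 Y0 U0; rewrite edivE ?average_ge0//.
set c := U `^ p^-1; pose A i := (Y i `^ p^-1) `^ (p + 1).
transitivity (\sum_i w i * (p * A i + - ((p + 1) * c) * Y i + c `^ (p + 1))).
  by apply: eq_bigr => i _; rewrite edivE// -/c -/(A i); congr (_ * _); ring.
rewrite average_affine {}/A.
set SA := \sum_i w i * (_ `^ _); set SY := \sum_i w i * Y i.
set B := (SY `^ _) `^ _; set C := c `^ _; clearbody SA SY B C c; ring.
Qed.

(** The supporting hyperplane at the two means, averaged.  There is no such
hyperplane when the mean of U is 0, but then U vanishes wherever the weight
does not, and [average_ediv_const] applies. *)
Lemma ediv_jensen p (Y U : I -> R) : 1 <= p ->
    (forall i, 0 <= Y i) -> (forall i, 0 <= U i) ->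
  ediv p (\sum_i w i * Y i) (\sum_i w i * U i) <=
  \sum_i w i * ediv p (Y i) (U i).
Proof.
move=> p1 Y0 U0; have p0 : 0 < p by lra.
have [Ya YaE] : exists x, \sum_i w i * Y i = x by eexists.
have [Ua UaE] : exists x, \sum_i w i * U i = x by eexists.
have Ya0 : 0 <= Ya by rewrite -YaE; exact: average_ge0.
have : 0 <= Ua by rewrite -UaE; exact: average_ge0.
rewrite YaE UaE.
rewrite le_eqVlt => /predU1P[Ua0|Ua0].
  have wU i : w i * U i = 0.
    by move: UaE; rewrite -Ua0 => /psumr_eq0P -> // j _; exact: mulr_ge0.
  have -> : \sum_i w i * ediv p (Y i) (U i) = \sum_i w i * ediv p (Y i) Ua.
    apply: eq_bigr => i _; have [wi0|wi0] := eqVneq (w i) 0.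
      by rewrite wi0 mul0r mul0r.
    have Ui0 : U i = 0.
      apply: (mulfI wi0).
      by rewrite wU mulr0.
    by rewrite Ui0 Ua0.
  rewrite average_ediv_const -?Ua0// YaE lerDr.
  have := average_ediv_const p0 Y0 Ya0; rewrite YaE ediv_self// addr0 => <-.
  by apply: average_ge0 => i; exact: ediv_ge0.
pose x0 := Ya `^ p^-1; pose y0 := Ua `^ p^-1.
have y00 : 0 < y0 by rewrite powR_gt0.
pose c1 := p * ((p + 1) * (x0 - y0)).
pose c2 := (p + 1) * (x0 `^ p - y0 `^ p) * (y0 / y0 `^ p).
have T i : w i * (c1 * Y i + (- c2) * U i + (- breg p x0 y0)) <=
    w i * (p * ediv p (Y i) (U i)).
  rewrite ler_wpM2l//.
  have := breg_ge_tangent p1 (powR_ge0 _ _ : 0 <= x0) y00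
     (powR_ge0 (Y i) p^-1) (powR_ge0 (U i) p^-1).
  have pn0 : p != 0 by rewrite gt_eqF.
  by rewrite (powR_rootK (Y0 i) pn0) (powR_rootK (U0 i) pn0) [- c2 * _]mulNr.
have := ler_sum (index_enum I) (fun i (_ : xpredT i) => T i).
under [X in _ <= X -> _]eq_bigr do rewrite mulrCA.
rewrite -mulr_sumr average_affine YaE UaE.
move=> S; rewrite -(ler_pM2l p0); apply: le_trans S.
have <- : x0 `^ p = Ya by rewrite powR_rootK// gt_eqF.
have <- : y0 `^ p = Ua by rewrite powR_rootK ?(ltW Ua0) ?gt_eqF.
have x00 : 0 <= x0 := powR_ge0 _ _.
rewrite (ediv_powR p0 x00 (ltW y00)) /c1 /c2 bregE.
rewrite (powRS x00 (ltW p0)) (powRS (ltW y00) (ltW p0)).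
rewrite le_eqVlt; apply/orP; left; apply/eqP.
have := powR_gt0 p y00; set a := x0 `^ p; set b := y0 `^ p.
by clearbody a b x0 y0 => b0; field; rewrite gt_eqF.
Qed.

End weighted_average.

End bregman_divergence.

(** * Tensorization on finite product spaces *)

(** Expectation under the product of the laws mu i. *)
HB.lock Definition Ex {R : realType} {I A : finType} (mu : I -> A -> R)
    (f : {ffun I -> A} -> R) : R :=
  \sum_(om : {ffun I -> A}) (\prod_i mu i (om i)) * f om.

Section product_space.
Context {R : realType} {I A : finType} (mu : I -> A -> R).
Hypotheses (mu0 : forall i a, 0 <= mu i a) (mu1 : forall i, \sum_a mu i a = 1).
Local Notation Om := {ffun I -> A}.
Local Notation Ex := (Ex mu).
Implicit Types (f g Y U : Om -> R) (om : Om) (p : R).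

Definition weight om : R := \prod_i mu i (om i).

Lemma ExE f : Ex f = \sum_om weight om * f om.
Proof. by rewrite unlock. Qed.

Definition upd om k a : Om := [ffun i => if i == k then a else om i].

Definition avg k f om : R := \sum_a mu k a * f (upd om k a).

Definition avgs (s : seq I) f : Om -> R := foldr avg f s.

Definition free_of k f := forall om a, f (upd om k a) = f om.

Lemma weight_ge0 om : 0 <= weight om.
Proof. exact: prodr_ge0. Qed.

Lemma sum_weight : \sum_om weight om = 1.
Proof.
rewrite /weight -(bigA_distr_bigA (fun i a => mu i a)) /=.
by rewrite big1.
Qed.

Lemma Ex_ge0 f : (forall om, 0 <= f om) -> 0 <= Ex f.
Proof. rewrite ExE; exact: average_ge0 weight_ge0 f. Qed.

Lemma ler_Ex f g : (forall om, f om <= g om) -> Ex f <= Ex g.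
Proof. by move=> fg; rewrite !ExE; apply: ler_sum => om _; rewrite ler_wpM2l// weight_ge0. Qed.

Lemma Ex_cst c : Ex (fun=> c) = c.
Proof. by rewrite !ExE -mulr_suml sum_weight mul1r. Qed.

Lemma eq_Ex f g : (forall om, f om = g om) -> Ex f = Ex g.
Proof. by move=> fg; rewrite !ExE; apply: eq_bigr => om _; rewrite fg. Qed.

Lemma ExD f g : Ex (fun om => f om + g om) = Ex f + Ex g.
Proof. by rewrite !ExE -big_split; apply: eq_bigr => om _; rewrite mulrDr. Qed.

Lemma ExB f g : Ex (fun om => f om - g om) = Ex f - Ex g.
Proof. by rewrite !ExE -sumrB; apply: eq_bigr => om _; rewrite mulrBr. Qed.

Lemma ExZ c f : Ex (fun om => c * f om) = c * Ex f.
Proof. by rewrite !ExE mulr_sumr; apply: eq_bigr => om _; rewrite mulrCA. Qed.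

Lemma Ex_sum (J : Type) (s : seq J) (F : J -> Om -> R) :
  Ex (fun om => \sum_(j <- s) F j om) = \sum_(j <- s) Ex (F j).
Proof.
rewrite ExE.
under eq_bigr do rewrite mulr_sumr.
by rewrite exchange_big; apply: eq_bigr => j _; rewrite ExE.
Qed.

Lemma upd_at om k a : upd om k a k = a.
Proof. by rewrite ffunE eqxx. Qed.

Lemma updK om k a : upd (upd om k a) k (om k) = om.
Proof. by apply/ffunP => i; rewrite !ffunE; case: eqP => // ->. Qed.

Lemma updC om j k a b : j != k -> upd (upd om k a) j b = upd (upd om j b) k a.
Proof.
move=> jk; apply/ffunP => i; rewrite !ffunE.
by case: eqP => [->|//]; rewrite (negPf jk).
Qed.

Lemma weight_upd om k a : weight (upd om k a) * mu k (om k) = weight om * mu k a.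
Proof.
rewrite /weight (bigD1 k)//= upd_at [in RHS](bigD1 k)//=.
under eq_bigr => i ik do rewrite ffunE (negPf ik).
by rewrite mulrAC [in RHS]mulrAC [mu k a * _]mulrC.
Qed.

(** Exchanging the k-th coordinate with an independent copy is an involution
that preserves the product of the two laws. *)
Lemma Ex_avg k f : Ex (avg k f) = Ex f.
Proof.
rewrite !ExE /avg.
under eq_bigr do rewrite mulr_sumr.
rewrite pair_big /=.
(* h exchanges the k-th coordinate with the second component. *)
pose h (u : Om * A) := (upd u.1 k u.2, u.1 k).
have hK : involutive h by move=> [om a]; rewrite /h /= updK upd_at.
rewrite (reindex_inj (inv_inj hK)) /=.
under eq_bigr => u _ do rewrite updK mulrA weight_upd -mulrA mulrCA.
rewrite -(pair_big xpredT xpredT (fun om a => mu k a * (weight om * f om))) /=.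
by apply: eq_bigr => om _; rewrite -mulr_suml mu1 mul1r.
Qed.

Lemma Ex_avgs s f : Ex (avgs s f) = Ex f.
Proof. by elim: s => //= k s IH; rewrite Ex_avg. Qed.

Lemma avgs_ge0 s f : (forall om, 0 <= f om) -> forall om, 0 <= avgs s f om.
Proof.
by move=> f0; elim: s => //= k s IH om; apply: (average_ge0 (mu0 k)) => a.
Qed.

Lemma free_of_avgs k s f : k \notin s -> free_of k f -> free_of k (avgs s f).
Proof.
move=> + fk; elim: s => //= j s IH; rewrite in_cons negb_or => /andP[kj /IH H] om a.
by apply: eq_bigr => b _; rewrite updC 1?eq_sym// H.
Qed.

Lemma avgs_local s f om om' :
  (forall i, i \notin s -> om i = om' i) -> avgs s f om = avgs s f om'.
Proof.
elim: s om om' => [|k s IH] om om' e /=.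
  by congr f; apply/ffunP => i; exact: e.
apply: eq_bigr => a _; congr (_ * _); apply: IH => i si; rewrite !ffunE.
by case: eqP => // /eqP ik; apply: e; rewrite in_cons negb_or ik.
Qed.

Lemma avgs_enum f om : avgs (enum I) f om = Ex f.
Proof.
rewrite -(Ex_avgs (enum I)) -[LHS]Ex_cst; apply: eq_Ex => om'.
by apply: avgs_local => i; rewrite mem_enum.
Qed.

Section tensorization.
Variables (phi : R -> R) (D : R -> R -> R).
Hypothesis D_var : forall (w Y : A -> R) (U : R), (forall a, 0 <= w a) ->
  \sum_a w a = 1 -> (forall a, 0 <= Y a) -> 0 <= U ->
  \sum_a w a * phi (Y a) - phi (\sum_a w a * Y a) <= \sum_a w a * D (Y a) U.
Hypothesis D_jensen : forall w Y U : A -> R, (forall a, 0 <= w a) ->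
  \sum_a w a = 1 -> (forall a, 0 <= Y a) -> (forall a, 0 <= U a) ->
  D (\sum_a w a * Y a) (\sum_a w a * U a) <= \sum_a w a * D (Y a) (U a).

Lemma jensen_avgs s Y U om :
  (forall om, 0 <= Y om) -> (forall om, 0 <= U om) ->
  D (avgs s Y om) (avgs s U om) <= avgs s (fun om => D (Y om) (U om)) om.
Proof.
move=> Y0 U0; elim: s om => //= k s IH om.
apply: le_trans (D_jensen (mu0 k) (mu1 k) _ _) _ => [a|a|].
- exact: avgs_ge0.
- exact: avgs_ge0.
- by apply: ler_sum => a _; rewrite ler_wpM2l.
Qed.

Lemma Ex_phi_avg k Y U :
  (forall om, 0 <= Y om) -> (forall om, 0 <= U om) -> free_of k U ->
  Ex (phi \o Y) - Ex (phi \o avg k Y) <= Ex (fun om => D (Y om) (U om)).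
Proof.
move=> Y0 U0 kU.
rewrite -(Ex_avg k (phi \o Y)) -(Ex_avg k (fun om => D _ _)) -ExB.
apply: ler_Ex => om.
have -> : avg k (fun om => D (Y om) (U om)) om =
    \sum_a mu k a * D (Y (upd om k a)) (U om).
  by apply: eq_bigr => a _; rewrite kU.
exact: D_var.
Qed.

(** Integrate the coordinates out one at a time, from Y to its mean.  Each
step costs the excess in Jensen's inequality for phi in one coordinate k, of a
partial average of Y.  By D_var this is at most the divergence to the same
partial average of U k, which is constant in that coordinate; by D_jensen the
divergence of the partial averages is at most that of Y and U k. *)
Lemma tensorization Y (U : I -> Om -> R) :
  (forall om, 0 <= Y om) -> (forall k om, 0 <= U k om) ->
  (forall k, free_of k (U k)) ->
  Ex (phi \o Y) - phi (Ex Y) <= \sum_k Ex (fun om => D (Y om) (U k om)).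
Proof.
move=> Y0 U0 kU.
suff H s : uniq s -> Ex (phi \o Y) - Ex (phi \o avgs s Y)
    <= \sum_(k <- s) Ex (fun om => D (Y om) (U k om)).
  have := H _ (enum_uniq I); rewrite big_enum /=.
  rewrite (@eq_Ex (phi \o avgs (enum I) Y) (fun=> phi (Ex Y))) ?Ex_cst// => om.
  by rewrite /= avgs_enum.
elim: s => [_|k s IH /= /andP[ks us]]; first by rewrite subrr big_nil.
rewrite big_cons -(subrKA (Ex (phi \o avgs s Y))) addrC lerD ?IH//.
apply: le_trans (Ex_phi_avg _ _ (free_of_avgs ks (kU k))) _ => [om|om|].
- exact: avgs_ge0.
- exact: avgs_ge0.
- by rewrite -[leRHS](Ex_avgs s); apply: ler_Ex => om; exact: jensen_avgs.
Qed.

End tensorization.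

Lemma breg_tensorization p (x : Om -> R) (y : I -> Om -> R) : 1 <= p ->
  (forall om, 0 <= x om) -> (forall k om, 0 <= y k om) ->
  (forall k, free_of k (y k)) ->
  p * (Ex (fun om => x om `^ (p + 1)) - (Ex (fun om => x om `^ p) `^ p^-1) `^ (p + 1))
  <= \sum_k Ex (fun om => breg p (x om) (y k om)).
Proof.
move=> p1 x0 y0 ky; have p0 : 0 < p := lt_le_trans ltr01 p1.
pose phi z : R := p * (z `^ p^-1) `^ (p + 1).
have D_var (w Y : A -> R) (U : R) : (forall a, 0 <= w a) ->
    \sum_a w a = 1 -> (forall a, 0 <= Y a) -> 0 <= U ->
    \sum_a w a * phi (Y a) - phi (\sum_a w a * Y a) <= \sum_a w a * ediv p (Y a) U.
  move=> w0 w1 Y0 U0; rewrite (average_ediv_const w0 w1 p0 Y0 U0).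
  rewrite mulrBr mulr_sumr.
  under [X in _ <= X - _ + _]eq_bigr do rewrite mulrCA.
  by rewrite lerDl ediv_ge0.
have D_jensen (w Y U : A -> R) := fun w0 w1 =>
  @ediv_jensen R A w w0 w1 p Y U p1.
have := tensorization D_var D_jensen (fun om => powR_ge0 (x om) p)
  (fun k om => powR_ge0 (y k om) p)
  (fun k om a => congr1 (fun z => z `^ p) (ky k om a)).
rewrite (@eq_Ex (phi \o _) (fun om => p * x om `^ (p + 1))) => [|om]; last first.
  by rewrite /= /phi root_powRK ?gt_eqF.
rewrite ExZ -mulrBr => /le_trans; apply.
apply: ler_sum => k _; apply: ler_Ex => om.
by rewrite ediv_powR.
Qed.

End product_space.

(** * Numerical inequalities for the induction on the exponent *)

Section real_lemmas.
Context {R : realType}.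
Implicit Types (q a b x y z A B c m : R).

(** The source of the constant kappa, see [kappaE]. *)
Lemma onemV_powR_le q : 1 <= q -> (1 - q^-1) `^ (q / 2) <= expR (- 2^-1).
Proof.
move=> q1; have q0 : 0 < q by lra.
have -> : - 2^-1 = - q^-1 * (q / 2) :> R by field; rewrite gt_eqF.
rewrite expRM; apply: ge0_ler_powR; rewrite ?nnegrE ?expR_ge0//.
- by rewrite divr_ge0// ltW.
- by rewrite subr_ge0 invf_le1.
- exact: expR_ge1Dx.
Qed.

Lemma powR_halfM x q : 0 <= x -> (x ^+ 2) `^ (q / 2) = x `^ q.
Proof.
move=> x0; rewrite -powR_mulrn// -powRrM; congr powR.
by rewrite mulrC mulfVK.
Qed.

Lemma powRD2 x q : 0 < x -> x `^ q = x ^+ 2 * x `^ (q - 2).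
Proof.
move=> x0; rewrite -powR_mulrn ?(ltW x0)// -powRD ?(gt_eqF x0) ?implybT//.
by congr powR; lra.
Qed.

Lemma powR_inv x q : 0 < x -> x^-1 `^ q = (x `^ q)^-1.
Proof.
move=> x0; have xq : x `^ q != 0 by rewrite gt_eqF// powR_gt0.
apply: (mulIf xq); rewrite mulVf// -powRM ?invr_ge0 ?(ltW x0)//.
by rewrite mulVf ?gt_eqF// powR1.
Qed.

Lemma powR_le_cancel a b (r s : R) : 0 < r -> 0 < s -> 0 <= a -> 0 <= b ->
  a `^ (s / r) <= b `^ s -> a <= b `^ r.
Proof.
move=> r0 s0 a0 b0 H.
have s_neq0 := lt0r_neq0 s0; have r_neq0 := lt0r_neq0 r0.
have sr0 : 0 <= r / s by rewrite divr_ge0 ?ltW.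
have {H} := ge0_ler_powR sr0 (powR_ge0 _ _) (powR_ge0 _ _) H.
have -> : (b `^ s) `^ (r / s) = b `^ r by rewrite -powRrM mulrC divfK.
have -> // : (a `^ (s / r)) `^ (r / s) = a.
by rewrite -powRrM mulrA divfK// divff// powRr1.
Qed.

(** The first term is at most (1 - 1/q)^(q/2) B2^(q/2), where
B2^(q/2 - 1) <= A^(q-2) and (1 - 1/q)^(q/2) <= e^(-1/2); divide by A^(q-2). *)
Lemma moment_recursion q A b B2 K : 2 <= q -> 0 < A -> 0 <= b ->
  b ^+ 2 <= (1 - q^-1) * B2 -> 0 <= B2 <= A ^+ 2 ->
  A `^ q <= b `^ q + K * A `^ (q - 2) ->
  A ^+ 2 <= expR (- 2^-1) * B2 + K.
Proof.
move=> q2 A0 b0 bB /andP[B0 BA] H.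
have q0 : 0 < q by lra.
have Ap : 0 < A `^ (q - 2) by rewrite powR_gt0.
rewrite -(ler_pM2r Ap) -powRD2// mulrDl; apply: (le_trans H); rewrite lerD2r.
rewrite -powR_halfM//.
have qi : 0 <= 1 - q^-1 by rewrite subr_ge0 invf_le1//; lra.
apply: (@le_trans _ _ (((1 - q^-1) * B2) `^ (q / 2))).
  apply: ge0_ler_powR; rewrite ?nnegrE ?sqr_ge0 ?mulr_ge0//.
    exact: ltW.
rewrite powRM// -mulrA; apply: ler_pM; rewrite ?powR_ge0//.
  by apply: onemV_powR_le; lra.
have q20 : 0 < q / 2 by rewrite divr_gt0.
rewrite -(mulr_powRB1 B0 q20) ler_wpM2l//.
have -> : A `^ (q - 2) = (A ^+ 2) `^ (q / 2 - 1).
  by rewrite -(powR_halfM (q - 2) (ltW A0)); congr powR; lra.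
by apply: ge0_ler_powR; rewrite ?nnegrE ?sqr_ge0//; lra.
Qed.

(** (1 + a / A)^(q - 2) <= e^(q a / A) <= e^(1/4) <= 4/3. *)
Lemma powRD_le_four_thirds q a A : 2 <= q -> 0 < a -> 4 * q * a <= A ->
  (A + a) `^ (q - 2) <= 4 / 3 * A `^ (q - 2).
Proof.
move=> q2 a0 aA.
have A0 : 0 < A by apply: lt_le_trans aA; rewrite mulr_gt0// mulr_gt0//; lra.
have -> : A + a = A * (1 + a / A) by field; rewrite gt_eqF.
have aA0 : 0 <= a / A by rewrite divr_ge0 ?ltW.
rewrite powRM ?(ltW A0) ?addr_ge0// mulrC ler_wpM2r ?powR_ge0//.
apply: (@le_trans _ _ (expR (a / A * (q - 2)))).
  rewrite expRM; apply: ge0_ler_powR; first by lra.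
  - by rewrite nnegrE addr_ge0.
  - by rewrite nnegrE expR_ge0.
  - exact: expR_ge1Dx.
apply: (@le_trans _ _ (expR 4^-1)).
  rewrite ler_expR mulrAC ler_pdivrMr// -ler_pdivrMl// invrK; nra.
have := @expR_ge1Dx R (- 4^-1); rewrite expRN.
have := @expR_gt0 R 4^-1; set e := expR _ => e0 H.
have : e * (1 + - 4^-1) <= e * e^-1 by rewrite ler_pM2l.
by rewrite divff ?gt_eqF//; lra.
Qed.

Lemma expRN_half_le : expR (- 2^-1) <= 2 / 3 :> R.
Proof.
rewrite expRN; have := @expR_ge1Dx R 2^-1 => H.
rewrite -[leRHS]invrK lef_pV2 ?posrE ?expR_gt0// invf_div; lra.
Qed.

(** The weighted arithmetic-geometric inequality for the exponents q, q and
q / (q - 2): first x y <= (x^2 + y^2) / 2, then Young's inequality for each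
square. *)
Lemma young3_powR q x y z : 2 <= q -> 0 <= x -> 0 <= y -> 0 <= z ->
  x * (y * z `^ (q - 2)) <= (x `^ q + y `^ q + (q - 2) * z `^ q) / q.
Proof.
move=> q2 x0 y0 z0.
have q0 : 0 < q by lra.
rewrite ler_pdivlMr// mulrC.
have sq (u : R) : 0 <= u -> u `^ q = (u ^+ 2) `^ (q / 2) by move/powR_halfM->.
have H1 : x * y <= ((x ^+ 2) + (y ^+ 2)) / 2.
  have : 0 <= (x - y) ^+ 2 by exact: sqr_ge0.
  by rewrite ler_pdivlMr//; nra.
have zp := powR_ge0 z (q - 2).
have H2 (u : R) : 0 <= u -> q * (u ^+ 2 * z `^ (q - 2)) <= 2 * u `^ q + (q - 2) * z `^ q.
  move=> u0; move: q2; rewrite le_eqVlt => /predU1P[<-|q2].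
    by rewrite subrr powRr0 mulr1 mul0r addr0 -powR_mulrn.
  have p0 : 0 < (q - 2) / 2 by rewrite divr_gt0// subr_gt0.
  have := young_powR p0 (sqr_ge0 z) (sqr_ge0 u).
  rewrite powR_halfM// (_ : (q - 2) / 2 + 1 = q / 2); last by lra.
  rewrite !powR_halfM// => H; lra.
have Hx := H2 x x0; have Hy := H2 y y0.
have : q * (x * y * z `^ (q - 2)) <= q * ((x ^+ 2 + y ^+ 2) / 2 * z `^ (q - 2)).
  by rewrite ler_pM2l// ler_wpM2r.
lra.
Qed.

Lemma kappaE : (2 * kappa R)^-1 = 1 - expR (- 2^-1).
Proof.
rewrite /kappa (_ : Num.sqrt (expR 1) = expR 2^-1); last first.
  have -> : expR 1 = expR 2^-1 ^+ 2 :> R.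
    by rewrite -expRM_natl mulfV.
  by rewrite sqrtr_sqr ger0_norm// expR_ge0.
rewrite expRN.
have e1 : 1 < expR 2^-1 :> R by rewrite expR_gt1.
have e0 : 0 < expR 2^-1 :> R by rewrite expR_gt0.
by field; rewrite !gt_eqF//; lra.
Qed.

Lemma kappa_gt0 : 0 < kappa R.
Proof.
have : 0 < (2 * kappa R)^-1.
  by rewrite kappaE subr_gt0 expR_lt1// oppr_lt0.
by rewrite invr_gt0 pmulr_rgt0.
Qed.

Lemma kappa_ge1 : 1 <= kappa R.
Proof.
have k0 := kappa_gt0.
have : (2 * kappa R)^-1 <= 2^-1.
  rewrite kappaE; have := @expR_ge1Dx R (- 2^-1); lra.
have k2 : 0 < 2 * kappa R by rewrite pmulr_rgt0.
by rewrite lef_pV2 ?posrE// => H; lra.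
Qed.

Lemma le_of_sqr_le_affine c m a : 0 <= c -> 0 <= m -> 0 <= a ->
  a ^+ 2 <= c * (m + a) -> a <= Num.sqrt (c * m) + c.
Proof.
move=> c0 m0 a0 H; rewrite leNgt; apply/negP => lt_a.
have cm : 0 <= c * m by rewrite mulr_ge0.
have s0 := sqrtr_ge0 (c * m); have := sqr_sqrtr cm.
set s := Num.sqrt _ in s0 lt_a * => s2; nra.
Qed.

End real_lemmas.

Section lower_tail_constants.
Context {R : realType}.
Implicit Types (q a m t : R).

Lemma le_of_sqrB_le t m a : 0 <= m -> 0 <= a -> 0 < t ->
  t ^+ 2 - m ^+ 2 <= a * t -> t <= m + a.
Proof.
move=> m0 a0 t0 H; rewrite leNgt; apply/negP => mat.
have h1 : 0 < (t - a - m) * t by rewrite mulr_gt0//; lra.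
have h2 : 0 <= m * (t - m) by rewrite mulr_ge0//; lra.
lra.
Qed.

Definition lower_bound q a m : R := 2 * (Num.sqrt (q * a * m) + 2 * (q * a)).

Lemma lower_bound_sqr_ge q a m : 1 <= q -> 0 <= a -> 0 <= m ->
  4 * (q * a * (m + a)) <= lower_bound q a m ^+ 2.
Proof.
move=> q1 a0 m0; have qa : 0 <= q * a by rewrite mulr_ge0//; lra.
have := sqr_sqrtr (mulr_ge0 qa m0); have := sqrtr_ge0 (q * a * m).
have aqa : q * a * a <= (q * a) ^+ 2.
  by rewrite expr2 ler_wpM2l// ler_peMl.
rewrite /lower_bound; set s := Num.sqrt _ => s0 s2.
have := mulr_ge0 s0 qa; have := sqr_ge0 (q * a); lra.
Qed.

(** Passing from q to q - 1 multiplies w = q a by r = 1 - 1/q.  In the expanded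
square the term 4 w m gains the factor r, the term 16 w^2 the factor r^2, and
the cross term the factor r from w, while its square root decreases. *)
Lemma lower_bound_pred q a m : 1 <= q -> 0 <= a -> 0 <= m ->
  lower_bound (q - 1) a m ^+ 2 <= (1 - q^-1) * lower_bound q a m ^+ 2.
Proof.
move=> q1 a0 m0; have q0 : 0 < q by lra.
have w0 : 0 <= q * a by rewrite mulr_ge0// ltW.
have p0 : 0 <= (q - 1) * a by rewrite mulr_ge0// subr_ge0.
have le_w : (q - 1) * a * m <= q * a * m by rewrite ler_wpM2r// ler_wpM2r//; lra.
have r0 : 0 <= 1 - q^-1 by rewrite subr_ge0 invf_le1.
have r1 : 1 - q^-1 <= 1 by rewrite gerBl invr_ge0 ltW.
have e1 : (q - 1) * a = (1 - q^-1) * (q * a) by field; rewrite gt_eqF.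
have := sqr_sqrtr (mulr_ge0 w0 m0); have := sqr_sqrtr (mulr_ge0 p0 m0).
have : Num.sqrt ((q - 1) * a * m) <= Num.sqrt (q * a * m) by rewrite ler_wsqrtr.
have := sqrtr_ge0 ((q - 1) * a * m); rewrite /lower_bound.
set s' := Num.sqrt ((q - 1) * a * m); set s := Num.sqrt _.
rewrite e1; set r := 1 - q^-1 in r0 r1 *; set w := q * a in w0 *.
clear -r0 r1 w0; clearbody s' s r w => s'0 ss' e' e.
have -> : (2 * (s' + 2 * (r * w))) ^+ 2 =
   4 * s' ^+ 2 + r * (16 * (s' * w) + 16 * r * w ^+ 2) by ring.
rewrite e'.
have -> : r * (2 * (s + 2 * w)) ^+ 2 = 4 * (r * s ^+ 2) + r * (16 * (s * w) + 16 * w ^+ 2) by ring.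
rewrite e -[r * w * m]mulrA lerD2l ler_wpM2l// lerD//.
  by rewrite ler_wpM2l// ler_wpM2r.
by rewrite -mulrA ler_wpM2l// ler_piMl// sqr_ge0.
Qed.

(** By [lower_bound_sqr_ge] the second term is at most a third of the square,
and e^(-1/2) <= 2/3. *)
Lemma lower_bound_absorb q a m : 1 <= q -> 0 <= a -> 0 <= m ->
  expR (- 2^-1) * lower_bound q a m ^+ 2 + 4 / 3 * (q * a * (m + a))
  <= lower_bound q a m ^+ 2.
Proof.
move=> q1 a0 m0; have := lower_bound_sqr_ge q1 a0 m0.
set B := lower_bound _ _ _ ^+ 2; have B0 : 0 <= B by exact: sqr_ge0.
have := ler_wpM2r B0 (@expRN_half_le R); lra.
Qed.

Lemma lower_bound_half q a m : 2 <= q -> 0 <= a -> 0 <= m ->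
  a * (m + a) <= (1 - q^-1) * lower_bound q a m ^+ 2.
Proof.
move=> q2 a0 m0; have q1 : 1 <= q by lra.
have h2 : 2^-1 <= 1 - q^-1.
  by have : q^-1 <= 2^-1; [rewrite lef_pV2// posrE; lra|lra].
apply: le_trans (ler_wpM2r (sqr_ge0 _) h2).
apply: le_trans (ler_wpM2l _ (lower_bound_sqr_ge q1 a0 m0)); last by rewrite invr_ge0.
have am0 : 0 <= a * (m + a) by rewrite mulr_ge0// addr_ge0.
have -> : 2^-1 * (4 * (q * a * (m + a))) = (2 * q) * (a * (m + a)) by field.
by rewrite ler_peMl//; lra.
Qed.

End lower_tail_constants.

(** * Norms on finite product spaces *)

(** The norm of L^r, for nonnegative functions. *)
HB.lock Definition nrm {R : realType} {I A : finType} (mu : I -> A -> R) (r : R)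
    (f : {ffun I -> A} -> R) : R := Ex mu (fun om => f om `^ r) `^ r^-1.

Section moments.
Context {R : realType} {I A : finType} (mu : I -> A -> R).
Hypotheses (mu0 : forall i a, 0 <= mu i a) (mu1 : forall i, \sum_a mu i a = 1).
Local Notation Om := {ffun I -> A}.
Local Notation E := (Ex mu).
Implicit Types (f g : Om -> R) (om : Om) (q r s a b c : R).

Local Notation nrm := (nrm mu).

Lemma nrmE r f : nrm r f = E (fun om => f om `^ r) `^ r^-1.
Proof. by rewrite unlock. Qed.

Lemma nrm_ge0 r f : 0 <= nrm r f. Proof. by rewrite nrmE powR_ge0. Qed.

Lemma nrm_powR r f : r != 0 -> nrm r f `^ r = E (fun om => f om `^ r).
Proof. by move=> r0; rewrite nrmE powR_rootK// Ex_ge0// => om; exact: powR_ge0. Qed.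

Lemma nrm_le r f c : 0 < r -> 0 <= c ->
  E (fun om => f om `^ r) <= c `^ r -> nrm r f <= c.
Proof.
move=> r0 c0 H; rewrite nrmE -(root_powRK c0 (lt0r_neq0 r0)).
apply: ge0_ler_powR; rewrite ?nnegrE ?invr_ge0 ?powR_ge0 ?(ltW r0)//.
by apply: Ex_ge0 => // om; exact: powR_ge0.
Qed.

(** The tangent at the mean, averaged. *)
Lemma Ex_powR_jensen t f : 1 <= t -> (forall om, 0 <= f om) ->
  E f `^ t <= E (fun om => f om `^ t).
Proof.
move=> t1 f0; set m := E f; have m0 : 0 <= m by exact: Ex_ge0.
pose c := t * m `^ (t - 1).
have H om : m `^ t + c * (f om - m) <= f om `^ t.
  by have := powR_ge_tangent t1 m0 (f0 om); rewrite -/c; lra.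
apply: le_trans (ler_Ex mu0 H).
by rewrite (ExD mu (fun=> _)) ExZ ExB !Ex_cst// -/m subrr mulr0 addr0.
Qed.

Lemma nrm_mono r s f : 0 < r -> r <= s -> (forall om, 0 <= f om) ->
  nrm r f <= nrm s f.
Proof.
move=> r0 rs f0; have s0 : 0 < s by exact: lt_le_trans rs.
apply: nrm_le => //; first exact: nrm_ge0.
have t1 : 1 <= s / r by rewrite ler_pdivlMr// mul1r.
have fr0 om : 0 <= f om `^ r by exact: powR_ge0.
have := Ex_powR_jensen t1 fr0.
have -> : E (fun om => (f om `^ r) `^ (s / r)) = E (fun om => f om `^ s).
  by apply: eq_Ex => om; rewrite -powRrM mulrC divfK// gt_eqF.
rewrite -(nrm_powR f (lt0r_neq0 s0)) => H.
exact: (powR_le_cancel r0 s0 (Ex_ge0 mu0 fr0) (nrm_ge0 s f) H).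
Qed.

Lemma Ex_normalized q f (e : R) : 0 < q -> 0 < e -> (forall om, 0 <= f om) ->
  E (fun om => f om `^ q) <= e `^ q -> E (fun om => (f om / e) `^ q) <= 1.
Proof.
move=> q0 e0 f0 fe.
have -> : E (fun om => (f om / e) `^ q) = E (fun om => (e `^ q)^-1 * f om `^ q).
  apply: eq_Ex => om; rewrite mulrC powRM ?invr_ge0 ?(ltW e0)//; congr (_ * _).
  exact: powR_inv.
by rewrite ExZ mulrC ler_pdivrMr ?powR_gt0// mul1r.
Qed.

(** Hoelder's inequality with exponents q, q and q / (q - 2): [young3_powR]
for the functions divided by the bounds on their norms. *)
Lemma Ex_hoelder3 q (M H u : Om -> R) a b c : 2 <= q ->
    0 < a -> 0 < b -> 0 < c ->
    (forall om, 0 <= M om) -> (forall om, 0 <= H om) -> (forall om, 0 <= u om) ->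
    E (fun om => M om `^ q) <= a `^ q -> E (fun om => H om `^ q) <= b `^ q ->
    E (fun om => u om `^ q) <= c `^ q ->
  E (fun om => M om * (H om * u om `^ (q - 2))) <= a * (b * c `^ (q - 2)).
Proof.
move=> q2 a0 b0 c0 M0 H0 u0 Ma Hb uc.
have q0 : 0 < q by lra.
pose K := a * (b * c `^ (q - 2)).
have K0 : 0 <= K by rewrite !mulr_ge0 ?powR_ge0// ltW.
have dv (x e : R) : 0 <= x -> 0 < e -> 0 <= x / e.
  by move=> x0 e0; rewrite divr_ge0// ltW.
have P om : M om * (H om * u om `^ (q - 2)) <= K / q *
    ((M om / a) `^ q + (H om / b) `^ q + (q - 2) * (u om / c) `^ q).
  have := young3_powR q2 (dv _ _ (M0 om) a0) (dv _ _ (H0 om) b0) (dv _ _ (u0 om) c0).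
  move=> /(ler_wpM2l K0).
  have -> : K * (M om / a * (H om / b * (u om / c) `^ (q - 2))) =
      M om * (H om * u om `^ (q - 2)).
    have -> : u om `^ (q - 2) = (u om / c) `^ (q - 2) * c `^ (q - 2).
      by rewrite -powRM ?dv ?(ltW c0)// divfK// gt_eqF.
    by rewrite /K; field; rewrite !gt_eqF.
  by rewrite [K / q * _]mulrAC -[K * _ / q]mulrA.
apply: (le_trans (ler_Ex mu0 P)); rewrite ExZ.
rewrite (ExD mu (fun om => _ + _)) (ExD mu (fun om => _ `^ _)) ExZ.
have := Ex_normalized q0 a0 M0 Ma; have := Ex_normalized q0 b0 H0 Hb; have := Ex_normalized q0 c0 u0 uc.
set e1 := E _; set e2 := E _; set e3 := E _ => h1 h2 h3.
have : e3 + e2 + (q - 2) * e1 <= q.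
  by have : (q - 2) * e1 <= (q - 2) * 1; [apply: ler_wpM2l; lra|lra].
move=> /(ler_wpM2l (divr_ge0 K0 (ltW q0))) /le_trans; apply.
by rewrite divfK ?gt_eqF.
Qed.

(** After normalization the sum is a convex combination with weights
a / (a + b) and b / (a + b), and the power is convex. *)
Lemma Ex_minkowski q f g a b : 1 <= q -> 0 < a -> 0 < b ->
    (forall om, 0 <= f om) -> (forall om, 0 <= g om) ->
    E (fun om => f om `^ q) <= a `^ q -> E (fun om => g om `^ q) <= b `^ q ->
  E (fun om => (f om + g om) `^ q) <= (a + b) `^ q.
Proof.
move=> q1 a0 b0 f0 g0 fa gb.
have q0 : 0 < q by lra.
have ab0 : 0 < a + b by rewrite addr_gt0.
pose d := a / (a + b); have d01 : 0 <= d <= 1.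
  by rewrite /d divr_ge0 ?(ltW a0) ?(ltW ab0)//= ler_pdivrMr// mul1r lerDl ltW.
have Eab : b / (a + b) = 1 - d by rewrite /d; field; rewrite gt_eqF.
have P om : (f om + g om) `^ q <=
    (a + b) `^ q * ((1 - d) * (g om / b) `^ q + d * (f om / a) `^ q).
  have -> : f om + g om = (a + b) * ((1 - d) * (g om / b) + d * (f om / a)).
    by rewrite -Eab /d; field; rewrite !gt_eqF.
  have fa0 : 0 <= f om / a by rewrite divr_ge0// ltW.
  have gb0 : 0 <= g om / b by rewrite divr_ge0// ltW.
  rewrite powRM ?(ltW ab0)//.
    by rewrite ler_wpM2l ?powR_ge0// powR_le_conv.
  by rewrite addr_ge0// mulr_ge0//; case/andP: d01; lra.
apply: (le_trans (ler_Ex mu0 P)); rewrite ExZ ExD !ExZ -[leRHS]mulr1.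
rewrite ler_wpM2l ?powR_ge0//.
have := Ex_normalized q0 a0 f0 fa; have := Ex_normalized q0 b0 g0 gb.
by move: d01 => /andP[d0 d1]; set e1 := E _; set e2 := E _ => h1 h2; nra.
Qed.

Lemma Ex_shift q c g b : 1 <= q -> 0 <= c -> 0 < b ->
    (forall om, 0 <= g om) -> E (fun om => g om `^ q) <= b `^ q ->
  E (fun om => (c + g om) `^ q) <= (c + b) `^ q.
Proof.
move=> q1; rewrite le_eqVlt => /predU1P[<- b0 g0 gb|c0 b0 g0 gb].
  by rewrite add0r; apply: le_trans gb; apply: ler_Ex => // om; rewrite add0r.
by apply: (@Ex_minkowski q (fun=> c)) => //; rewrite ?Ex_cst// => _; exact: ltW.
Qed.

End moments.

(** * Moments of self-bounding functions *)

Section self_bounding.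
Context {R : realType} {I A : finType} (mu : I -> A -> R).
Hypotheses (mu0 : forall i a, 0 <= mu i a) (mu1 : forall i, \sum_a mu i a = 1).
Local Notation Om := {ffun I -> A}.
Local Notation E := (Ex mu).
Variables (h M : Om -> R) (hk : I -> Om -> R).
Hypotheses (M0 : forall om, 0 <= M om) (hk0 : forall k om, 0 <= hk k om).
Hypotheses (hk_le : forall k om, hk k om <= h om).
Hypotheses (hk_M : forall k om, h om - hk k om <= M om).
Hypotheses (hk_sum : forall om, \sum_k (h om - hk k om) <= h om).
Hypotheses (hk_free : forall k, free_of k (hk k)).
Implicit Types (om : Om) (k : I) (q r a b c : R).

Let m := E h.
Let pos (z : R) := Num.max z 0.
Let up om := pos (h om - m).
Let dn om := pos (m - h om).

Let h0 om : 0 <= h om.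
Proof.
by apply: le_trans (hk_sum om); apply: sumr_ge0 => k _; rewrite subr_ge0.
Qed.

Let m0 : 0 <= m. Proof. exact: Ex_ge0. Qed.

Let pos_ge0 z : 0 <= pos z. Proof. by rewrite /pos le_max lexx orbT. Qed.

Let pos_le z y : z <= y -> pos z <= pos y.
Proof. by move=> zy; rewrite /pos ge_max !le_max zy lexx orbT. Qed.

Let pos_lip z y : z <= y -> pos y - pos z <= y - z.
Proof. by rewrite /pos => zy; case: (leP y 0) => ?; case: (leP z 0) => ?; lra. Qed.

Let pos_sqr z : pos z ^+ 2 <= z ^+ 2.
Proof. by rewrite /pos; case: (leP z 0) => // _; rewrite expr0n/= sqr_ge0. Qed.

Let sum_le om (F : I -> R) (X : R) : 0 <= X ->
  (forall k, F k <= (h om - hk k om) * X) -> \sum_k F k <= h om * X.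
Proof.
move=> X0 FX; apply: (@le_trans _ _ (\sum_k (h om - hk k om) * X)).
  exact: ler_sum.
by rewrite -mulr_suml ler_wpM2r.
Qed.

(** The case p = 1 of the tensorization inequality, where the divergence is
the square (h - hk)^2 and is at most (h - hk) M. *)
Lemma variance_le : E (fun om => h om ^+ 2) - m ^+ 2 <= E (fun om => M om * h om).
Proof.
have := breg_tensorization mu0 mu1 (lexx 1) h0 hk0 hk_free.
have sq (z : R) : 0 <= z -> z `^ (1 + 1) = z ^+ 2.
  by move=> z0; rewrite (_ : 1 + 1 = 2%:R) ?powR_mulrn// -natr1.
rewrite mul1r invr1.
rewrite (@eq_Ex _ _ _ _ _ (fun om => h om ^+ 2)) => [|om]; last exact: sq.
rewrite (@eq_Ex _ _ _ _ (fun om => h om `^ 1) h) => [|om]; last by rewrite powRr1.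
rewrite -/m powRr1// sq// => /le_trans; apply.
rewrite -(Ex_sum mu (index_enum I) (fun k om => breg 1 (h om) (hk k om))).
apply: ler_Ex => // om; rewrite mulrC; apply: sum_le => // k.
rewrite bregE !powRr1// !sq//.
have := ler_wpM2l (_ : 0 <= h om - hk k om) (hk_M k om).
by rewrite subr_ge0 => /(_ (hk_le k om)); lra.
Qed.

(** Tensorization for p = q - 1 and the positive part of h - m.  The map
z |-> max(z, 0) is nondecreasing and contracting, so each divergence is at most
q (q - 1) / 2 times (h - hk) M x^(q-2), and the differences h - hk add up to
at most h. *)
Lemma up_recursion q : 2 <= q ->
  E (fun om => up om `^ q) <=
  nrm mu (q - 1) up `^ q + q / 2 * E (fun om => M om * (h om * up om `^ (q - 2))).
Proof.
move=> q2; have p1 : 1 <= q - 1 by lra.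
have p0 : 0 < q - 1 by lra.
have := @breg_tensorization _ _ _ _ mu0 mu1 (q - 1) up (fun k om => pos (hk k om - m)) p1
  (fun om => pos_ge0 _) (fun k om => pos_ge0 _)
  (fun k om x => congr1 (fun z => pos (z - m)) (hk_free k om x)).
rewrite subrK -nrmE.
rewrite -(Ex_sum mu (index_enum I)
  (fun k om => breg (q - 1) (up om) (pos (hk k om - m)))) => H.
rewrite addrC -lerBlDr -(ler_pM2l p0); apply: (le_trans H).
rewrite mulrA -ExZ; apply: ler_Ex => // om.
have c0 : 0 <= q * (q - 1) / 2 by rewrite divr_ge0// mulr_ge0//; lra.
rewrite (_ : (q - 1) * (q / 2) * _ =
   h om * (q * (q - 1) / 2 * (M om * up om `^ (q - 2)))); last by ring.
apply: sum_le => [|k]; first by rewrite mulr_ge0// mulr_ge0// powR_ge0.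
have yx : 0 <= pos (hk k om - m) <= up om.
  by rewrite pos_ge0/=; apply: pos_le; rewrite lerD2r.
apply: (le_trans (breg_le_sqr p1 yx)).
rewrite subrK (_ : q - 1 - 1 = q - 2); last by lra.
rewrite (_ : (h om - hk k om) * _ = q * (q - 1) / 2 *
   ((h om - hk k om) * M om * up om `^ (q - 2))); last by ring.
rewrite ler_wpM2l// ler_wpM2r ?powR_ge0//.
have d0 : 0 <= up om - pos (hk k om - m) by rewrite subr_ge0; case/andP: yx.
have d1 : up om - pos (hk k om - m) <= h om - hk k om.
  apply: (le_trans (pos_lip _)); first by rewrite lerD2r.
  by rewrite opprB addrA subrK.
by rewrite expr2; apply: ler_pM => //; exact: le_trans (hk_M k om).
Qed.

(** The power is now that of the larger number (m - hk)_+, which exceeds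
(m - h)_+ by at most M.  Summing produces a factor h, which the lower tail does
not control from above; but all the terms vanish when h >= m + M, because
then every hk is at least m, so that m + M can replace h. *)
Lemma dn_recursion q : 2 <= q ->
  E (fun om => dn om `^ q) <=
  nrm mu (q - 1) dn `^ q +
  q * E (fun om => M om * ((m + M om) * (dn om + M om) `^ (q - 2))).
Proof.
move=> q2; have p1 : 1 <= q - 1 by lra.
have p0 : 0 < q - 1 by lra.
have := @breg_tensorization _ _ _ _ mu0 mu1 (q - 1) dn (fun k om => pos (m - hk k om)) p1
  (fun om => pos_ge0 _) (fun k om => pos_ge0 _)
  (fun k om x => congr1 (fun z => pos (m - z)) (hk_free k om x)).
rewrite subrK -nrmE.
rewrite -(Ex_sum mu (index_enum I)
  (fun k om => breg (q - 1) (dn om) (pos (m - hk k om)))) => H.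
rewrite addrC -lerBlDr -(ler_pM2l p0); apply: (le_trans H).
rewrite mulrA -ExZ; apply: ler_Ex => // om.
have c0 : 0 <= q * (q - 1) by rewrite mulr_ge0//; lra.
have dM0 : 0 <= dn om + M om by exact: addr_ge0 (pos_ge0 _) (M0 om).
have term k : breg (q - 1) (dn om) (pos (m - hk k om)) <=
    q * (q - 1) * ((dn om - pos (m - hk k om)) ^+ 2 * pos (m - hk k om) `^ (q - 2)).
  have xy : 0 <= dn om <= pos (m - hk k om).
    by rewrite pos_ge0/=; apply: pos_le; rewrite lerD2l lerN2.
  apply: (le_trans (breg_le_sqr_rev p1 xy)).
  by rewrite subrK (_ : q - 1 - 1 = q - 2)//; lra.
have X0 : 0 <= q * (q - 1) * (M om * (dn om + M om) `^ (q - 2)).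
  exact: mulr_ge0 c0 (mulr_ge0 (M0 om) (powR_ge0 _ _)).
(* Every (m - hk)_+ vanishes in the first case. *)
have [hm|hm] := leP (m + M om) (h om).
  apply: (@le_trans _ _ 0); last first.
    rewrite [_ * q]mulrC mulr_ge0// mulr_ge0// mulr_ge0 ?powR_ge0//.
    exact: addr_ge0.
  apply: sumr_le0 => k _; apply: (le_trans (term k)).
  have hkm : m - hk k om <= 0 by have := hk_M k om; lra.
  have Mo := M0 om.
  rewrite /dn /pos !max_r// ?subrr ?expr0n ?mul0r ?mulr0//; lra.
apply: (@le_trans _ _ (h om * (q * (q - 1) * (M om * (dn om + M om) `^ (q - 2))))).
  apply: sum_le => // k; apply: (le_trans (term k)).
  rewrite (_ : (h om - hk k om) * _ = q * (q - 1) *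
     ((h om - hk k om) * M om * (dn om + M om) `^ (q - 2))); last by ring.
  rewrite ler_wpM2l//.
  have d1 : pos (m - hk k om) - dn om <= h om - hk k om.
    apply: (le_trans (pos_lip _)); first by rewrite lerD2l lerN2.
    by rewrite opprB addrC addrA subrK.
  have d0 : 0 <= pos (m - hk k om) - dn om.
    by rewrite subr_ge0; apply: pos_le; rewrite lerD2l lerN2.
  apply: ler_pM; rewrite ?sqr_ge0 ?powR_ge0//.
    rewrite -sqrrN opprB expr2; apply: ler_pM => //; exact: le_trans (hk_M k om).
  apply: ge0_ler_powR; rewrite ?nnegrE//; first by lra.
  by have := hk_M k om; lra.
rewrite (_ : (q - 1) * q * _ = (m + M om) *
   (q * (q - 1) * (M om * (dn om + M om) `^ (q - 2)))); last by ring.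
by rewrite ler_wpM2r// ltW.
Qed.

Local Notation nrm := (nrm mu).

Let up_ge0 om : 0 <= up om. Proof. exact: pos_ge0. Qed.
Let dn_ge0 om : 0 <= dn om. Proof. exact: pos_ge0. Qed.

Let sqr_mono (x y : R) : 0 <= x -> x <= y -> x ^+ 2 <= y ^+ 2.
Proof. by move=> x0 xy; rewrite !expr2 ler_pM. Qed.

Lemma Ex_powR_mono r q a : 0 < r -> r <= q -> 0 <= a ->
  E (fun om => M om `^ q) <= a `^ q -> E (fun om => M om `^ r) <= a `^ r.
Proof.
move=> r0 rq a0 Ma; have q0 : 0 < q by exact: lt_le_trans rq.
rewrite -(nrm_powR mu0 M (lt0r_neq0 r0)).
apply: ge0_ler_powR; rewrite ?nnegrE ?nrm_ge0 ?(ltW r0)//.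
by apply: (le_trans (nrm_mono mu0 mu1 r0 rq M0)); exact: nrm_le.
Qed.

(** Used for the positive and for the negative part of h - m. *)
Lemma centered_le_variance (f : Om -> R) : (forall om, f om ^+ 2 <= (h om - m) ^+ 2) ->
  E (fun om => f om ^+ 2) <= E (fun om => M om * h om).
Proof.
move=> fh; apply: le_trans variance_le.
apply: (le_trans (ler_Ex mu0 fh)).
have -> : E (fun om => (h om - m) ^+ 2) =
    E (fun om => h om ^+ 2 - (2 * m * h om - m ^+ 2)).
  by apply: eq_Ex => om; ring.
by rewrite ExB (ExB mu (fun om => _ * _)) ExZ Ex_cst// -/m; lra.
Qed.

(** Hoelder's inequality with h <= m + (h - m)_+. *)
Lemma up_hoelder q a : 2 <= q -> 0 < a -> 0 < nrm q up ->
  E (fun om => M om `^ q) <= a `^ q ->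
  E (fun om => M om * (h om * up om `^ (q - 2))) <=
  a * (m + nrm q up) * nrm q up `^ (q - 2).
Proof.
move=> q2 a0 A0 Ma; have q0 : 0 < q by lra.
have uA : E (fun om => up om `^ q) <= nrm q up `^ q.
  by rewrite nrm_powR// gt_eqF.
have b0 : 0 < m + nrm q up by rewrite ltr_wpDl.
have H0 om : 0 <= m + up om by rewrite addr_ge0.
have Hb : E (fun om => (m + up om) `^ q) <= (m + nrm q up) `^ q.
  by apply: (Ex_shift mu0 mu1) => //; lra.
have := Ex_hoelder3 mu0 q2 a0 b0 A0 M0 H0 up_ge0 Ma Hb uA.
rewrite mulrA; apply: le_trans.
apply: ler_Ex => // om; rewrite ler_wpM2l// ler_wpM2r ?powR_ge0//.
by rewrite /up /pos -lerBlDl le_max lexx.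
Qed.

Lemma nrm2_sqr f : (forall om, 0 <= f om) -> nrm 2 f ^+ 2 = E (fun om => f om ^+ 2).
Proof.
move=> f0; have := nrm_powR mu0 f (_ : 2 != 0 :> R).
rewrite pnatr_eq0 => /(_ isT); rewrite powR_mulrn ?nrm_ge0// => ->.
by apply: eq_Ex => om; rewrite powR_mulrn.
Qed.

(** The second moment of the positive part is at most the variance, hence at
most E[M h], which [up_hoelder] bounds. *)
Lemma up_base a : 0 < a -> E (fun om => M om `^ 2) <= a `^ 2 ->
  nrm 2 up ^+ 2 <= a * (m + nrm 2 up).
Proof.
move=> a0 Ma; have := nrm_ge0 mu 2 up; rewrite le_eqVlt => /predU1P[A0|A0].
  by rewrite -A0 expr0n/= addr0 mulr_ge0// ltW.
have := up_hoelder (lexx 2) a0 A0 Ma.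
rewrite subrr powRr0 mulr1 => /(le_trans _); apply.
rewrite (nrm2_sqr up_ge0) (_ : E (fun om => M om * _) = E (fun om => M om * h om)).
  by apply: centered_le_variance => om; exact: pos_sqr.
by apply: eq_Ex => om; rewrite powRr0 mulr1.
Qed.

(** If the conclusion failed, B2 = kappa q a (m + N) would be less than N^2,
with N the norm of order q.  Then [moment_recursion] applies and gives
N^2 <= e^(-1/2) B2 + (q / 2) a (m + N), which is B2 by the choice of kappa. *)
Lemma up_step q a : 2 <= q -> 0 < a -> E (fun om => M om `^ q) <= a `^ q ->
  nrm (q - 1) up ^+ 2 <= kappa R * (q - 1) * (a * (m + nrm q up)) ->
  nrm q up ^+ 2 <= kappa R * q * (a * (m + nrm q up)).
Proof.
move=> q2 a0 Ma; have q0 : 0 < q by lra.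
have k0 := @kappa_gt0 R; have rec := up_recursion q2.
have hol := @up_hoelder q a q2 a0; rewrite -(nrm_powR mu0 up (lt0r_neq0 q0)) in rec.
have := nrm_ge0 mu q up.
set N := nrm q up in rec hol *; set v := a * (m + N) in hol *; move=> N0 bB.
have v0 : 0 <= v by exact: mulr_ge0 (ltW a0) (addr_ge0 m0 N0).
have B0 : 0 <= kappa R * q * v.
  exact: mulr_ge0 (mulr_ge0 (ltW k0) (ltW q0)) v0.
move: N0; rewrite le_eqVlt => /predU1P[N0|N0]; first by rewrite -N0 expr0n.
have {}hol := hol N0 Ma.
rewrite leNgt; apply/negP => BA.
suff : N ^+ 2 <= kappa R * q * v by rewrite leNgt BA.
have bB' : nrm (q - 1) up ^+ 2 <= (1 - q^-1) * (kappa R * q * v).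
  apply: (le_trans bB); rewrite le_eqVlt; apply/orP; left; apply/eqP.
  by field; rewrite gt_eqF.
have rec' : N `^ q <= nrm (q - 1) up `^ q + q / 2 * v * N `^ (q - 2).
  apply: (le_trans rec); rewrite lerD2l -[q / 2 * v * _]mulrA.
  apply: ler_wpM2l => //; apply: divr_ge0 => //.
  exact: ltW.
have BA' : 0 <= kappa R * q * v <= N ^+ 2 by rewrite B0 ltW.
apply: (le_trans (moment_recursion q2 N0 (nrm_ge0 _ _ _) bB' BA' rec')).
(* 1 / (2 kappa) = 1 - e^(-1/2) is the room left by the first term. *)
have -> : q / 2 * v = (2 * kappa R)^-1 * (kappa R * q * v).
  by field; rewrite gt_eqF.
by rewrite kappaE -mulrDl addrC subrK mul1r.
Qed.

(** The recursions relate the exponents q and q - 1, so that an induction over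
real exponents has to start from all of [2, 3). *)
Lemma unit_step_ind (P : R -> Prop) :
  (forall q, 2 <= q < 3 -> P q) -> (forall q, 3 <= q -> P (q - 1) -> P q) ->
  forall q, 2 <= q -> P q.
Proof.
move=> P0 PS q q2.
have [N qN] : exists N : nat, q < 3 + N%:R.
  by exists (Num.truncn q); have := truncnS_gt q; rewrite -natr1; lra.
elim: N => [|N IH] in q q2 qN *; first by apply: P0; lra.
have [q3|q3] := ltP q 3; first by apply: P0; lra.
by apply: PS => //; apply: IH; move: qN; rewrite -natr1; lra.
Qed.

Lemma up_sqr_le q a : 2 <= q -> 0 < a -> E (fun om => M om `^ q) <= a `^ q ->
  nrm q up ^+ 2 <= kappa R * q * (a * (m + nrm q up)).
Proof.
move=> q2 a0; have k1 := @kappa_ge1 R.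
elim/unit_step_ind : q / q2 => [q /andP[q2 q3] Ma|q q3 IH Ma].
- apply: up_step => //.
  have b2 : nrm (q - 1) up <= nrm 2 up by apply: nrm_mono => //; lra.
  have b3 : nrm 2 up <= nrm q up by apply: nrm_mono => //; lra.
  have Ma2 := Ex_powR_mono (ltr0Sn R 1) q2 (ltW a0) Ma.
  apply: (@le_trans _ _ (nrm 2 up ^+ 2)).
    exact: sqr_mono (nrm_ge0 _ _ _) _.
  apply: (le_trans (up_base a0 Ma2)).
  have am : a * (m + nrm 2 up) <= a * (m + nrm q up).
    by rewrite ler_pM2l// lerD2l.
  apply: (le_trans am); rewrite ler_peMl//; last by nra.
  by rewrite mulr_ge0 ?(ltW a0)// addr_ge0 ?nrm_ge0.
- have b3 : nrm (q - 1) up <= nrm q up by apply: nrm_mono => //; lra.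
  have q2 : 2 <= q by lra.
  apply: up_step => //.
  have Ma1 : E (fun om => M om `^ (q - 1)) <= a `^ (q - 1).
    by apply: (Ex_powR_mono _ _ _ Ma); lra.
  apply: (le_trans (IH Ma1)); rewrite ler_wpM2l//; first by rewrite mulr_ge0//; lra.
  by rewrite ler_pM2l// lerD2l.
Qed.

Theorem up_moment q a : 2 <= q -> 0 < a -> E (fun om => M om `^ q) <= a `^ q ->
  nrm q up <= Num.sqrt (kappa R * q * a * m) + kappa R * q * a.
Proof.
move=> q2 a0 Ma; have := up_sqr_le q2 a0 Ma; rewrite mulrA.
apply: le_of_sqr_le_affine => //; last exact: nrm_ge0.
have q0 : 0 <= q by exact: le_trans q2.
exact: mulr_ge0 (mulr_ge0 (ltW (@kappa_gt0 R)) q0) (ltW a0).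
Qed.

Lemma Ex_Mh_le a b : 0 < a -> 0 < b -> E (fun om => M om `^ 2) <= a `^ 2 ->
  E (fun om => h om `^ 2) <= b `^ 2 -> E (fun om => M om * h om) <= a * b.
Proof.
move=> a0 b0 Ma hb.
have u1 : E (fun _ => 1 `^ 2) <= 1 `^ 2 by rewrite powR1 Ex_cst.
have := Ex_hoelder3 mu0 (lexx 2) a0 b0 ltr01 M0 h0 (fun=> ler01) Ma hb u1.
rewrite !powR1 mulr1; congr (_ <= _).
by apply: eq_Ex => om; rewrite mulr1.
Qed.

(** The second moment t^2 of h satisfies t^2 - m^2 <= E[M h] <= a t, which
forces t <= m + a; hence E[M h] <= a (m + a). *)
Lemma dn_base a : 0 < a -> E (fun om => M om `^ 2) <= a `^ 2 ->
  nrm 2 dn ^+ 2 <= a * (m + a).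
Proof.
move=> a0 Ma; rewrite (nrm2_sqr dn_ge0).
apply: (@le_trans _ _ (E (fun om => M om * h om))).
  apply: centered_le_variance => om; apply: (le_trans (pos_sqr _)).
  by rewrite -sqrrN opprB.
have Var := variance_le; rewrite -(nrm2_sqr h0) in Var.
have := nrm_ge0 mu 2 h.
have := nrm_powR mu0 h (_ : 2 != 0 :> R); rewrite pnatr_eq0 => /(_ isT) tE.
rewrite le_eqVlt => /predU1P[t0|t0].
  apply: (@le_trans _ _ (a * a)); last by rewrite ler_pM2l// lerDr.
  by apply: Ex_Mh_le => //; rewrite -tE -t0 powR0 ?powR_ge0// pnatr_eq0.
set t := nrm 2 h in t0 Var tE.
have H : E (fun om => M om * h om) <= a * t by apply: Ex_Mh_le => //; rewrite tE.
apply: (le_trans H); rewrite ler_pM2l//.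
exact: (le_of_sqrB_le m0 (ltW a0) t0 (le_trans Var H)).
Qed.

Local Notation bound q a := (lower_bound q a m).

(** By contradiction, as in [up_step].  The assumption that the norm N exceeds
the bound also gives N >= 4 q a, which is what allows (N + a)^(q-2) to be
replaced by a multiple of N^(q-2). *)
Lemma dn_step q a : 2 <= q -> 0 < a -> E (fun om => M om `^ q) <= a `^ q ->
  nrm (q - 1) dn ^+ 2 <= (1 - q^-1) * bound q a ^+ 2 ->
  nrm q dn <= bound q a.
Proof.
move=> q2 a0 Ma; have q0 : 0 < q by lra.
have q1 : 1 <= q by lra.
have rec := dn_recursion q2; rewrite -(nrm_powR mu0 dn (lt0r_neq0 q0)) in rec.
have uN : E (fun om => dn om `^ q) <= nrm q dn `^ q by rewrite nrm_powR// gt_eqF.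
set N := nrm q dn in rec uN *; move=> bB.
have qa : 0 < q * a by rewrite mulr_gt0.
have B_ge : 4 * q * a <= bound q a.
  by rewrite /lower_bound; have := sqrtr_ge0 (q * a * m); lra.
have B0 : 0 < bound q a by apply: lt_le_trans B_ge; rewrite -mulrA mulr_gt0.
rewrite leNgt; apply/negP => BN; have N0 := lt_trans B0 BN.
suff N2 : N ^+ 2 <= bound q a ^+ 2.
  have : bound q a * bound q a < N * N by apply: ltr_pM => //; exact: ltW.
  by rewrite -!expr2 ltNge N2.
have ma0 : 0 < m + a by rewrite ltr_wpDl.
have Na0 : 0 < N + a by rewrite addr_gt0.
have mM0 om : 0 <= m + M om by rewrite addr_ge0.
have dM0 om : 0 <= dn om + M om by rewrite addr_ge0.
have mMa := Ex_shift mu0 mu1 q1 m0 a0 M0 Ma.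
have dMa := Ex_minkowski mu0 q1 N0 a0 dn_ge0 M0 uN Ma.
have hol := Ex_hoelder3 mu0 q2 a0 ma0 Na0 M0 mM0 dM0 Ma mMa dMa.
have four := powRD_le_four_thirds q2 a0 (le_trans B_ge (ltW BN)).
have rec' : N `^ q <= nrm (q - 1) dn `^ q + 4 / 3 * (q * a * (m + a)) * N `^ (q - 2).
  apply: (le_trans rec); rewrite lerD2l.
  apply: (le_trans (ler_wpM2l (ltW q0) hol)).
  set X := (N + a) `^ _ in four *; set Y := N `^ _ in four *.
  have -> : q * (a * ((m + a) * X)) = q * a * (m + a) * X by rewrite !mulrA.
  have -> : 4 / 3 * (q * a * (m + a)) * Y = q * a * (m + a) * (4 / 3 * Y).
    by rewrite [RHS]mulrA [q * a * (m + a) * (4 / 3)]mulrC.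
  by rewrite ler_wpM2l// mulr_ge0 ?ltW.
have BN' : 0 <= bound q a ^+ 2 <= N ^+ 2.
  by rewrite sqr_ge0/= (sqr_mono (ltW B0) (ltW BN)).
apply: (le_trans (moment_recursion q2 N0 (nrm_ge0 _ _ _) bB BN' rec')).
exact: lower_bound_absorb q1 (ltW a0) m0.
Qed.

Theorem dn_moment q a : 2 <= q -> 0 < a -> E (fun om => M om `^ q) <= a `^ q ->
  nrm q dn <= 2 * (Num.sqrt (q * a * m) + 2 * (q * a)).
Proof.
move=> q2 a0; rewrite -/(bound q a).
elim/unit_step_ind : q / q2 => [q /andP[q2 q3] Ma|q q3 IH Ma].
- apply: dn_step => //.
  have b2 : nrm (q - 1) dn <= nrm 2 dn by apply: nrm_mono => //; lra.
  have Ma2 := Ex_powR_mono (ltr0Sn R 1) q2 (ltW a0) Ma.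
  apply: (le_trans (sqr_mono (nrm_ge0 _ _ _) b2)).
  apply: (le_trans (dn_base a0 Ma2)).
  exact: lower_bound_half q2 (ltW a0) m0.
- have q2 : 2 <= q by lra.
  apply: dn_step => //.
  have Ma1 : E (fun om => M om `^ (q - 1)) <= a `^ (q - 1).
    by apply: (Ex_powR_mono _ _ _ Ma); lra.
  apply: le_trans (lower_bound_pred (le_trans (ler1n R 2) q2) (ltW a0) m0).
  exact: sqr_mono (nrm_ge0 _ _ _) (IH Ma1).
Qed.

End self_bounding.

(** * Rademacher averages are self-bounding *)

Section max_abs.
Context {R : realType} {J : finType}.
Implicit Types (x y : J -> R) (c : R).

Definition max_abs x : R := \big[Num.max/0]_j `|x j|.

Lemma max_abs_ge0 x : 0 <= max_abs x.
Proof. exact: bigmax_ge_id. Qed.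

Lemma le_max_abs x j : `|x j| <= max_abs x.
Proof. exact: le_bigmax. Qed.

Lemma max_abs_le x c : 0 <= c -> (forall j, `|x j| <= c) -> max_abs x <= c.
Proof. by move=> c0 xc; apply: bigmax_le. Qed.

Lemma max_abs_attained x : max_abs x = 0 \/ exists j, max_abs x = `|x j|.
Proof.
case: (pickP (xpredT : pred J)) => [j _|J0]; last first.
  by left; rewrite /max_abs big_pred0.
have [//|i _ e] := @eq_bigmax _ _ J 0 j xpredT (fun j => `|x j|) isT.
by right; exists i.
Qed.

End max_abs.

Section rademacher_average.
Context {R : realType} {I J : finType}.
Local Notation signs := {ffun I -> bool}.
Implicit Types (c : I -> J -> R) (s : signs) (k : I).

Definition sgn (b : bool) : R := (-1) ^+ b.

Definition signed_sum s c j : R := \sum_i sgn (s i) * c i j.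

Definition rad_avg c : R := 2^-1 ^+ #|I| * \sum_(s : signs) max_abs (signed_sum s c).

Definition drop_row k c i j : R := if i == k then 0 else c i j.

Definition flip k s : signs := [ffun i => if i == k then ~~ s i else s i].

Lemma flipK k : involutive (flip k).
Proof.
by move=> s; apply/ffunP => i; rewrite !ffunE; case: eqP => // _; rewrite negbK.
Qed.

Lemma normr_sgn b : `|sgn b| = 1 :> R.
Proof. by case: b; rewrite /sgn ?expr1 ?normrN ?expr0 normr1. Qed.

Lemma sgnN b : sgn (~~ b) = - sgn b :> R.
Proof. by case: b; rewrite /sgn /= ?expr1 ?expr0 ?opprK. Qed.

Lemma signed_sum_drop k s c j :
  signed_sum s (drop_row k c) j = signed_sum s c j - sgn (s k) * c k j.
Proof.
rewrite /signed_sum (bigD1 k)//= [X in _ = X - _](bigD1 k)//= /drop_row eqxx.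
rewrite mulr0 add0r addrAC subrr add0r.
by apply: eq_bigr => i /negPf ->.
Qed.

Lemma signed_sum_flip k s c j :
  signed_sum (flip k s) c j = signed_sum s c j - 2 * (sgn (s k) * c k j).
Proof.
rewrite /signed_sum (bigD1 k)//= [X in _ = X - _](bigD1 k)//= ffunE eqxx sgnN.
rewrite (eq_bigr (fun i => sgn (s i) * c i j)); first by ring.
by move=> i /negPf ik; rewrite ffunE ik.
Qed.

Lemma half_pow_gt0 : 0 < 2^-1 ^+ #|I| :> R.
Proof. by rewrite exprn_gt0. Qed.

Lemma rad_avg_ge0 c : 0 <= rad_avg c.
Proof. by rewrite mulr_ge0 ?(ltW half_pow_gt0)// sumr_ge0// => s _; exact: max_abs_ge0. Qed.

Lemma half_sum_cst (B : R) : 2^-1 ^+ #|I| * \sum_(s : signs) B = B.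
Proof.
by rewrite sumr_const card_ffun card_bool -[B *+ _]mulr_natl natrX mulrA exprVn
  mulVf ?mul1r.
Qed.

(** The signed sum without row k is the mean of the signed sums for s and for
s with its k-th sign flipped, and flipping permutes the sign vectors. *)
Lemma rad_avg_drop_le k c : rad_avg (drop_row k c) <= rad_avg c.
Proof.
rewrite ler_pM2l ?half_pow_gt0//.
have -> : \sum_(s : signs) max_abs (signed_sum s c) =
    \sum_(s : signs) 2^-1 * (max_abs (signed_sum s c) + max_abs (signed_sum (flip k s) c)).
  rewrite -mulr_sumr big_split /= [X in _ + X](_ : _ = \sum_s max_abs (signed_sum s c)).
    by field.
  by rewrite [RHS](reindex_inj (inv_inj (flipK k))).
apply: ler_sum => s _; apply: max_abs_le => [|j].
  by rewrite mulr_ge0// addr_ge0// max_abs_ge0.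
have -> : signed_sum s (drop_row k c) j =
    2^-1 * (signed_sum s c j + signed_sum (flip k s) c j).
  by rewrite signed_sum_drop signed_sum_flip; field.
rewrite normrM ger0_norm// ler_wpM2l//.
by apply: (le_trans (ler_normD _ _)); rewrite lerD// le_max_abs.
Qed.

Lemma rad_avg_drop_ge k c (B : R) : (forall j, `|c k j| <= B) -> 0 <= B ->
  rad_avg c - rad_avg (drop_row k c) <= B.
Proof.
move=> cB B0; rewrite -mulrBr -sumrB -[leRHS]half_sum_cst.
rewrite ler_pM2l ?half_pow_gt0//; apply: ler_sum => s _.
rewrite lerBlDr; apply: max_abs_le => [|j]; first by rewrite addr_ge0 ?max_abs_ge0.
have -> : signed_sum s c j = sgn (s k) * c k j + signed_sum s (drop_row k c) j.
  by rewrite signed_sum_drop; ring.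
apply: (le_trans (ler_normD _ _)); rewrite lerD ?le_max_abs//.
by rewrite normrM normr_sgn mul1r.
Qed.

(** For each sign vector choose a column j that attains the maximum.  Dropping
row k loses at most the k-th summand of column j, taken with the sign of the
sum of the column, and these summands add up to the maximum. *)
Lemma rad_avg_drop_sum c : \sum_k (rad_avg c - rad_avg (drop_row k c)) <= rad_avg c.
Proof.
rewrite /rad_avg; under eq_bigr do rewrite -mulrBr -sumrB.
rewrite -mulr_sumr exchange_big /= ler_pM2l ?half_pow_gt0//.
apply: ler_sum => s _.
have [->|[j je]] := max_abs_attained (signed_sum s c).
  by apply: sumr_le0 => k _; rewrite sub0r oppr_le0 max_abs_ge0.
(* e turns the absolute value of column j into a sum over the rows. *)
pose e := Num.sg (signed_sum s c j).
have -> : max_abs (signed_sum s c) = \sum_k e * (sgn (s k) * c k j).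
  by rewrite je normrEsg mulr_sumr.
apply: ler_sum => k _; rewrite -mulr_sumr.
rewrite lerBlDr -lerBlDl; apply: le_trans (le_max_abs _ j).
rewrite signed_sum_drop -mulrBr; apply: (le_trans (ler_norm _)).
rewrite normrM -[leRHS]mul1r ler_wpM2r//.
by rewrite /e; case: sgrP; rewrite ?normrN ?normr0 ?normr1.
Qed.

Lemma rad_avg_le c (B : R) : 0 <= B -> (forall i j, `|c i j| <= B) -> rad_avg c <= #|I|%:R * B.
Proof.
move=> B0 cB; rewrite -[leRHS]half_sum_cst ler_pM2l ?half_pow_gt0//.
apply: ler_sum => s _; apply: max_abs_le => [|j]; first by rewrite mulr_ge0.
apply: (le_trans (ler_norm_sum _ _ _)); rewrite mulr_natl -sumr_const.
by apply: ler_sum => i _; rewrite normrM normr_sgn mul1r.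
Qed.

End rademacher_average.

(** * Integration over a sub-sigma-algebra *)

Section sub_sigma_algebra.
Context d (T : measurableType d) (R : realType) (mu : {measure set T -> \bar R}).
Local Open Scope ereal_scope.

(** On the function extended by 0 outside of E, the measure mu is the sum of
its restrictions to E and to the complement of E, and the second one does not
see this function. *)
Lemma ge0_integral_mrestr (E : set T) (mE : measurable E) (A : set T) (f : T -> \bar R) :
  measurable A -> measurable_fun A f -> (forall x, A x -> 0 <= f x) ->
  \int[mrestr mu mE]_(x in A) f x = \int[mu]_(x in A `&` E) f x.
Proof.
move=> mA mf f0; have mEC := measurableC mE.
have mAE : measurable_fun (A `&` E) f by apply: measurable_funS mf => //; exact: subIsetl.
have mg : measurable_fun A (f \_ E).
  exact: (proj1 (measurable_restrict f mE mA) mAE).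
have g0 x : A x -> 0 <= (f \_ E) x.
  by move=> Ax; rewrite patchE; case: ifPn => // _; exact: f0.
rewrite integral_mkcondr.
have -> : \int[mu]_(x in A) (f \_ E) x =
    \int[measure_add (mrestr mu mE) (mrestr mu mEC)]_(x in A) (f \_ E) x.
  apply: eq_measure_integral => B mB _.
  rewrite -[RHS]/(measure_add (mrestr mu mE) (mrestr mu mEC) B) measure_addE.
  rewrite -[X in X + _]/(mu (B `&` E)) -[X in _ + X]/(mu (B `&` ~` E)).
  rewrite -measureU//; first by rewrite -setIUr setUv setIT.
  - exact: measurableI.
  - exact: measurableI.
  - by rewrite setIACA setICr setI0.
rewrite ge0_integral_measure_add// [X in _ + X](_ : _ = 0) ?adde0.
  apply: ge0_ae_eq_integral => //; exists (~` E); split => //.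
    by rewrite -[LHS]/(mu (~` E `&` E)) setICl measure0.
  move=> x /= /not_implyP[Ax]; rewrite patchE; case: ifPn => // xE _ Ex.
  by move/negP: xE; apply; rewrite inE.
rewrite (@ge0_ae_eq_integral _ _ _ _ A (f \_ E) (cst 0))// ?integral0//.
exists E; split => //; first by rewrite -[LHS]/(mu (E `&` ~` E)) setICr measure0.
move=> x /= /not_implyP[Ax]; rewrite patchE; case: ifPn => //.
by rewrite inE.
Qed.

Variables (G : set (set T)) (sG : sigma_algebra setT G) (GT : G `<=` measurable).
Let T' := g_sigma_algebraType G.
Let idG : T -> T' := id.

Lemma measurable_sub (A : set T) : measurable (A : set T') = G A.
Proof.
rewrite /measurable /=; apply/propext; split; last exact: sub_sigma_algebra.
by move/(_ G); apply; split.
Qed.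

Lemma measurable_fun_sub d' (V : measurableType d') (f : T -> V) :
  (forall B, measurable B -> G (f @^-1` B)) -> measurable_fun [set: T'] f.
Proof. by move=> fG _ B mB; rewrite setTI measurable_sub; exact: fG. Qed.

Lemma measurable_idG : measurable_fun [set: T] idG.
Proof.
by move=> _ B; rewrite setTI measurable_sub => GB; exact: GT.
Qed.

Let idGm : {mfun T >-> T'} := HB.pack idG (isMeasurableFun.Build _ _ _ _ idG measurable_idG).

(** Seen from (T, G), the restriction of mu to E and c mu are the same measure;
the identity map to (T, G) transports the integrals. *)
Lemma ge0_integral_indep (E : set T) (c : {nonneg R}) (f : T -> \bar R) (A : set T) :
  measurable E -> (forall B, G B -> mu (B `&` E) = c%:num%:E * mu B) ->
  (forall x, 0 <= f x) -> (forall B, measurable B -> G (f @^-1` B)) -> G A ->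
  \int[mu]_(x in A `&` E) f x = c%:num%:E * \int[mu]_(x in A) f x.
Proof.
move=> mE ind f0 fG GA.
have mf : measurable_fun [set: T'] f by exact: measurable_fun_sub.
have mfT : measurable_fun [set: T] f by move=> _ B mB; rewrite setTI; exact/GT/fG.
have mA : measurable (A : set T') by rewrite measurable_sub.
have mAT := GT GA.
rewrite -ge0_integral_mrestr//; last exact: measurable_funTS.
transitivity (\int[pushforward (mrestr mu mE) idGm]_(x in A) f x).
  by rewrite ge0_integral_pushforward//; exact: measurable_funTS.
transitivity (\int[pushforward (mscale c mu) idGm]_(x in A) f x).
  by apply: eq_measure_integral => B; rewrite measurable_sub => GB _; exact: ind.
rewrite ge0_integral_pushforward//; last exact: measurable_funTS.
by rewrite ge0_integral_mscale//; exact: measurable_funTS.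
Qed.

Lemma integral_idG (A : set T) (f : T -> \bar R) :
  (forall B, measurable B -> G (f @^-1` B)) -> G A ->
  \int[pushforward mu idGm]_(x in A) f x = \int[mu]_(x in A) f x.
Proof.
move=> fG GA; have mf : measurable_fun [set: T'] f by exact: measurable_fun_sub.
have mA : measurable (A : set T') by rewrite measurable_sub.
rewrite [LHS]integralE [RHS]integralE; congr (_ - _).
- rewrite ge0_integral_pushforward//.
  by apply: measurable_funTS; exact: measurable_funepos.
- rewrite ge0_integral_pushforward//.
  by apply: measurable_funTS; exact: measurable_funeneg.
Qed.

(** Uniqueness of conditional expectations, from the equality of integrals
over all measurable sets of (T, G). *)
Lemma sub_sigma_ae_eq (f g : T -> \bar R) :
  (forall B, measurable B -> G (f @^-1` B)) ->
  (forall B, measurable B -> G (g @^-1` B)) ->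
  mu.-integrable setT f ->
  (forall A, G A -> \int[mu]_(x in A) f x = \int[mu]_(x in A) g x) ->
  ae_eq mu setT f g.
Proof.
move=> fG gG fi fg.
have mf : measurable_fun [set: T'] f by exact: measurable_fun_sub.
have mg : measurable_fun [set: T'] g by exact: measurable_fun_sub.
have fi' : (pushforward mu idGm).-integrable [set: T'] f.
  apply/integrableP; split => //.
  rewrite ge0_integral_pushforward//; last exact: measurableT_comp.
  by case/integrableP : fi.
have fg' E : E `<=` [set: T'] -> measurable (E : set T') ->
    \int[pushforward mu idGm]_(x in E) f x = \int[pushforward mu idGm]_(x in E) g x.
  by move=> _; rewrite measurable_sub => GE; rewrite !integral_idG//; exact: fg.
have [N [mN N0 sN]] := integral_ae_eq measurableT fi' mg fg'.
exists N; split => //; apply: GT.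
by move: mN; rewrite measurable_sub.
Qed.

End sub_sigma_algebra.

(** * Quantization of the class *)

Section quantizer.
Context {R : realType} (m : nat).
Implicit Types (x y : R).

(** The sign of x and the number of whole units 1/m in its absolute value,
capped at m * m units so that there are finitely many codes. *)
Definition quant_code x : bool * 'I_(m * m).+1 :=
  (x < 0, inord (minn (Num.truncn (`|x| * m%:R)) (m * m))).

Definition quant_value (c : bool * 'I_(m * m).+1) : R :=
  sgn c.1 * ((c.2 : nat)%:R / m%:R).

Definition quant x : R := quant_value (quant_code x).

Lemma quant_code2 x :
  (quant_code x).2 = minn (Num.truncn (`|x| * m%:R)) (m * m) :> nat.
Proof. by rewrite /= inordK// ltnS geq_minr. Qed.

Lemma sgn_lt0 x : sgn (x < 0) * `|x| = x.
Proof.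
rewrite /sgn; case: (ltP x 0) => x0 /=.
  by rewrite expr1 ltr0_norm// mulrNN mul1r.
by rewrite expr0 ger0_norm// mul1r.
Qed.

Hypothesis m0 : (0 < m)%N.

Lemma normr_quant_le x : `|quant x| <= `|x|.
Proof.
rewrite /quant /quant_value quant_code2 normrM normr_sgn mul1r.
rewrite ger0_norm; last by rewrite divr_ge0.
rewrite ler_pdivrMr ?ltr0n//.
apply: (@le_trans _ _ (Num.truncn (`|x| * m%:R))%:R); first by rewrite ler_nat geq_minl.
by rewrite truncn_le mulr_ge0.
Qed.

Lemma quant_dist_le x : `|x| <= m%:R -> `|quant x - x| <= m%:R^-1.
Proof.
move=> xm; rewrite /quant /quant_value quant_code2 -[X in _ - X](sgn_lt0 x) -mulrBr.
rewrite normrM normr_sgn mul1r.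
have m_gt0 : 0 < m%:R :> R by rewrite ltr0n.
have /minn_idPl -> : (Num.truncn (`|x| * m%:R) <= m * m)%N.
  rewrite -ltnS truncn_lt_nat; last by rewrite mulr_ge0.
  apply: (@le_lt_trans _ _ (m%:R * m%:R)); first by rewrite ler_wpM2r.
  by rewrite -natrM ltr_nat ltnS.
have /truncn_itv /andP[t1 t2] : 0 <= `|x| * m%:R by rewrite mulr_ge0.
rewrite -[X in _ <= X]mul1r -(ler_pM2r m_gt0) divfK ?gt_eqF//.
rewrite -[X in _ * X <= _](gtr0_norm m_gt0) -normrM mulrBl divfK ?gt_eqF//.
by rewrite ler_norml; move: t1 t2; rewrite -natr1; lra.
Qed.

Lemma measurable_quant_code c : measurable [set x | quant_code x = c].
Proof.
case: c => b i.
have -> : [set x | quant_code x = (b, i)] =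
    [set x | (x < 0) = b] `&`
    ([set x | i%:R <= `|x| * m%:R] `&`
     [set x | (`|x| * m%:R < i.+1%:R) || (i == m * m :> nat)%N]).
  apply/seteqP; split => x /=.
    move=> e; have := quant_code2 x; rewrite e /= => iE; split.
      by have [] : (x < 0, (quant_code x).2) = (b, i) by rewrite -e.
    have xm0 : 0 <= `|x| * m%:R by rewrite mulr_ge0.
    split; first by rewrite -truncn_ge_nat// iE geq_minl.
    rewrite -truncn_lt_nat// ltnS iE.
    by case: (leqP (Num.truncn (`|x| * m%:R)) (m * m)); rewrite ?leqnn ?eqxx ?orbT.
  move=> [xb [xi xi']]; rewrite /quant_code xb; congr (_, _).
  have xm0 : 0 <= `|x| * m%:R by rewrite mulr_ge0.
  apply/val_inj => /=; rewrite inordK ?ltnS ?geq_minr//.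
  move: xi xi'; rewrite -truncn_ge_nat// -truncn_lt_nat// ltnS => h1 /orP[h2|/eqP h2].
    have -> : Num.truncn (`|x| * m%:R) = i by apply/eqP; rewrite eqn_leq h1 h2.
    by apply/minn_idPl; rewrite -ltnS.
  by rewrite [RHS]h2; apply/minn_idPr; rewrite -h2.
have my : measurable_fun [set: R] (fun x => `|x| * m%:R).
  by apply: measurable_funM => //; exact: measurableT_comp.
apply: measurableI; [|apply: measurableI].
- have mlt : measurable_fun [set: R] (fun x => x < 0) by exact: measurable_fun_ltr.
  have := mlt measurableT [set b] I; rewrite setTI.
  by congr (measurable _); apply/seteqP; split.
- have := measurable_fun_ler (@measurable_cst _ _ R R setT i%:R) my.
  move=> /(_ measurableT [set true] I); rewrite setTI.
  by congr (measurable _); apply/seteqP; split.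
- (* The last code absorbs all larger values. *)
have [_|_] := eqVneq (i : nat) (m * m)%N.
    rewrite (_ : [set _ | _] = setT)//; apply/seteqP; split => // x _ /=.
    by rewrite orbT.
  have := measurable_fun_ltr my (@measurable_cst _ _ R R setT i.+1%:R).
  move=> /(_ measurableT [set true] I); rewrite setTI.
  by congr (measurable _); apply/seteqP; split => x /=; rewrite orbF.
Qed.

End quantizer.

Lemma cvg_fin_sum {R : realType} (J : finType) (f : J -> nat -> R) (l : J -> R) :
  (forall j, f j m @[m --> \oo] --> l j) ->
  (\sum_j f j m) @[m --> \oo] --> \sum_j l j.
Proof.
move=> fl; elim: (index_enum J) => [|j r IH].
  by rewrite big_nil; under eq_cvg do rewrite big_nil; exact: cvg_cst.
by rewrite big_cons; under eq_cvg do rewrite big_cons; apply: cvgD.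
Qed.

Section conditional_average.
Context {R : realType} (U : Type) (n : nat) (g : nat -> U -> R).
Implicit Types (s : {ffun 'I_n -> bool}) (u : 'I_n -> U) (B : R).

Definition sign_sum s u j : R := \sum_i sgn (s i) * g j (u i).

Definition sup_sum s u : \bar R :=
  ereal_sup (range (fun j => `|sign_sum s u j|%:E)).

(** The average over the sign vectors of the supremum over the class that g
enumerates, as a function of the sample. *)
Definition cond_rad u : \bar R :=
  ((2^-1 ^+ #|'I_n|)%:E * \sum_s sup_sum s u)%E.

Definition quant_rad m u : R :=
  rad_avg (fun i (j : 'I_m) => quant m (g j (u i))).

Lemma sup_sum_ge0 s u : (0 <= sup_sum s u)%E.
Proof.
apply: le_trans (ereal_sup_ubound _); last by exists 0%N.
by rewrite lee_fin.
Qed.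

Lemma cond_rad_ge0 u : (0 <= cond_rad u)%E.
Proof.
by rewrite mule_ge0 ?lee_fin ?exprn_ge0 ?invr_ge0// sume_ge0// => s _; exact: sup_sum_ge0.
Qed.

Lemma norm_sign_sum_le s u j B : (forall i, `|g j (u i)| <= B) ->
  `|sign_sum s u j| <= n%:R * B.
Proof.
move=> gB; apply: (le_trans (ler_norm_sum _ _ _)).
rewrite mulr_natl -[n in _ *+ n]card_ord -sumr_const.
by apply: ler_sum => i _; rewrite normrM normr_sgn mul1r.
Qed.

Lemma sup_sum_le s u B : (forall i j, `|g j (u i)| <= B) ->
  (sup_sum s u <= (n%:R * B)%:E)%E.
Proof.
move=> gB; apply: ge_ereal_sup => _ [j _ <-]; rewrite lee_fin.
by apply: norm_sign_sum_le => i.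
Qed.

Lemma quant_rad_ge0 m u : 0 <= quant_rad m u. Proof. exact: rad_avg_ge0. Qed.

Lemma quant_rad_le m u B : (0 < m)%N -> 0 <= B -> (forall i j, `|g j (u i)| <= B) ->
  quant_rad m u <= n%:R * B.
Proof.
move=> m0 B0 gB; rewrite -[n in n%:R]card_ord; apply: rad_avg_le => // i j.
exact: le_trans (normr_quant_le m0 _) _.
Qed.

(** The maximum over the first m functions eventually sees one whose signed
sum is nearly the supremum, and the n rounding errors add up to at most n / m
once m exceeds the bound B. *)
Lemma max_abs_quant_cvg s u B : (forall i j, `|g j (u i)| <= B) ->
  max_abs (signed_sum s (fun i (j : 'I_m) => quant m (g j (u i)))) @[m --> \oo]
    --> fine (sup_sum s u).
Proof.
move=> gB; set sg := fine _.
have supE : sup_sum s u = sg%:E.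
  rewrite /sg fineK// ge0_fin_numE ?sup_sum_ge0//.
  exact: le_lt_trans (sup_sum_le s gB) (ltry _).
have le_sg j : `|sign_sum s u j| <= sg.
  by rewrite -lee_fin -supE; apply: ereal_sup_ubound; exists j.
apply/cvgrPdist_le => e e0.
have [j0 j0e] : exists j, sg - e / 2 < `|sign_sum s u j|.
  have : ((sg - e / 2)%:E < sup_sum s u)%E by rewrite supE lte_fin; lra.
  by move/ereal_sup_gt => [_ [j _ <-]]; rewrite lte_fin => ?; exists j.
near=> m.
have m0 : (0 < m)%N by near: m; exact: nbhs_infty_gt.
have mB : B <= m%:R by near: m; exact: nbhs_infty_ger.
have jm : (j0 < m)%N by near: m; exact: nbhs_infty_gt.
have me : n%:R / m%:R <= e / 2.
  rewrite ler_pdivrMr ?ltr0n// mulrC -ler_pdivrMr ?divr_gt0//.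
  by near: m; exact: nbhs_infty_ger.
have dist (j : 'I_m) :
    `|signed_sum s (fun i (j : 'I_m) => quant m (g j (u i))) j - sign_sum s u j| <= e / 2.
  apply: le_trans me; rewrite /signed_sum /sign_sum -sumrB.
  apply: (le_trans (ler_norm_sum _ _ _)).
  rewrite mulr_natl -[n in _ *+ n]card_ord -sumr_const.
  apply: ler_sum => i _; rewrite -mulrBr normrM normr_sgn mul1r.
  by apply: quant_dist_le => //; exact: le_trans (gB _ _) mB.
set c := fun i (j : 'I_m) => _ in dist *.
rewrite ler_distl; apply/andP; split; last first.
  have := le_max_abs (signed_sum s c) (Ordinal jm).
  have := dist (Ordinal jm); have := ler_dist_dist (signed_sum s c (Ordinal jm)) (sign_sum s u j0).
  rewrite /= => h1 h2 h3; have := le_trans h1 h2; rewrite ler_distl => /andP[h4 _]; lra.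
rewrite lerBlDr; apply: max_abs_le => [|j].
  by rewrite addr_ge0 ?(ltW e0)//; exact: le_trans (le_sg 0%N).
have := le_trans (ler_dist_dist _ _) (dist j); rewrite ler_distl => /andP[_ h1].
have := le_sg j; lra.
Unshelve. all: by end_near. Qed.

Lemma quant_rad_cvg u B : (forall i j, `|g j (u i)| <= B) ->
  cond_rad u \is a fin_num /\ quant_rad m u @[m --> \oo] --> fine (cond_rad u).
Proof.
move=> gB.
have sup_fin s : sup_sum s u \is a fin_num.
  rewrite ge0_fin_numE ?sup_sum_ge0//.
  exact: le_lt_trans (sup_sum_le s gB) (ltry _).
have E : cond_rad u = (2^-1 ^+ #|'I_n| * \sum_s fine (sup_sum s u))%:E.
  rewrite /cond_rad EFinM -sumEFin; congr (_ * _)%E.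
  by apply: eq_bigr => s _; rewrite fineK.
split; first by rewrite E.
rewrite E /=; apply: cvgMr; apply: cvg_fin_sum => s.
exact: max_abs_quant_cvg gB.
Qed.

End conditional_average.

(** * Moments of the quantized averages *)

Lemma measurable_sup_sum {R : realType} d dU (T : measurableType d)
    (U : measurableType dU) (n : nat) (g : nat -> U -> R) (Y : 'I_n -> T -> U) s :
  (forall j, measurable_fun setT (g j)) -> (forall i, measurable_fun setT (Y i)) ->
  measurable_fun setT (fun w => sup_sum g s (fun i => Y i w)).
Proof.
move=> mg mY; pose f j w := `|sign_sum g s (fun i => Y i w) j|%:E.
rewrite (_ : (fun w => _) = (fun w => esups (f ^~ w) 0)); last first.
  apply/funext => w; rewrite /esups /sup_sum /=; congr ereal_sup.
  by apply/seteqP; split => _ [j _ <-]; exists j.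
apply: measurable_fun_esups => j; apply/measurable_EFinP.
apply: measurableT_comp => //; apply: measurable_sum => i.
by apply: measurable_funM => //; exact: measurableT_comp (mg j) (mY i).
Qed.

Lemma measurable_cond_rad {R : realType} d dU (T : measurableType d)
    (U : measurableType dU) (n : nat) (g : nat -> U -> R) (Y : 'I_n -> T -> U) :
  (forall j, measurable_fun setT (g j)) -> (forall i, measurable_fun setT (Y i)) ->
  measurable_fun setT (fun w => cond_rad g (fun i => Y i w)).
Proof.
move=> mg mY; apply: measurable_funeM; apply: emeasurable_sum => s.
exact: measurable_sup_sum.
Qed.

Section finite_law.
Context d dU (T : measurableType d) (U : measurableType dU) (R : realType).
Context (P : probability T R) (n : nat) (X : 'I_n -> {RV P >-> U}) (A : finType).
Variable cell : U -> A.
Hypothesis cell_meas : forall a, measurable (cell @^-1` [set a]).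
Hypothesis indepX : independent_RVs X.
Local Notation Om := {ffun 'I_n -> A}.

Let ev i a : set T := X i @^-1` (cell @^-1` [set a]).

Let mev i a : measurable (ev i a).
Proof. by rewrite /ev -[X in measurable X]setTI; exact: measurable_funP. Qed.

Definition cell_law i a : R := fine (P (ev i a)).

Lemma cell_law_ge0 i a : 0 <= cell_law i a.
Proof. by rewrite fine_ge0. Qed.

Let PevE i a : P (ev i a) = (cell_law i a)%:E.
Proof. by rewrite /cell_law fineK// fin_num_measure. Qed.

(** The indicators of the cells add up to 1 everywhere. *)
Lemma cell_law_sum i : \sum_a cell_law i a = 1.
Proof.
apply: EFin_inj; rewrite -sumEFin.
under eq_bigr do rewrite -PevE -[ev _ _]setIT -integral_indic//.
rewrite -ge0_integral_sum//.
  rewrite -[RHS](@probability_setT _ _ _ P) -[in RHS](setTI setT) -integral_indic//.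
  apply: eq_integral => w _; rewrite indicT sumEFin /=; congr EFin.
  rewrite (bigD1 (cell (X i w)))//= big1 ?addr0.
    by rewrite indicE mem_set.
  move=> a /eqP ne; rewrite indicE memNset// => /= e; exact: ne.
by move=> a; apply/measurable_EFinP; exact: measurable_indic.
Qed.

Definition cells w : Om := [ffun i => cell (X i w)].

Let evs (om : Om) : set T := \bigcap_(i in [set` [set: 'I_n]%SET]) ev i (om i).

Let mevs om : measurable (evs om).
Proof. by apply: fin_bigcap_measurable => // i _; exact: mev. Qed.

Let evsE om w : evs om w <-> cells w = om.
Proof.
split=> [ew|<- i _].
  by apply/ffunP => i; rewrite ffunE; apply: (ew i); rewrite /= inE.
by rewrite /ev /= ffunE.
Qed.

Let P_evs om : P (evs om) = (\prod_i cell_law i (om i))%:E.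
Proof.
rewrite indepX; last first.
  by move=> i _; exists (cell @^-1` [set om i]) => //; rewrite setTI.
rewrite -prodEFin; apply: eq_big => [i|i _]; first by rewrite inE.
exact: PevE.
Qed.

Lemma cells_sum (f : Om -> R) w : f (cells w) = \sum_om f om * \1_(evs om) w.
Proof.
rewrite (bigD1 (cells w))//= big1 ?addr0.
  by rewrite indicE mem_set ?mulr1//; apply/evsE.
move=> om /eqP ne; rewrite indicE memNset ?mulr0// => /evsE e.
by apply: ne.
Qed.

Lemma measurable_cells (f : Om -> R) : measurable_fun setT (fun w => f (cells w)).
Proof.
rewrite (_ : (fun w => _) = fun w => \sum_om f om * \1_(evs om) w).
  by apply: measurable_sum => om; apply: measurable_funM.
by apply/funext => w; exact: cells_sum.
Qed.

(** By independence, the joint law of the cells is the product of their laws. *)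
Lemma integral_cells (f : Om -> R) : (forall om, 0 <= f om) ->
  (\int[P]_w (f (cells w))%:E = (Ex cell_law f)%:E)%E.
Proof.
move=> f0; under eq_integral do rewrite cells_sum -sumEFin.
rewrite ge0_integral_sum//; first last.
- by move=> om w _; rewrite lee_fin mulr_ge0.
- by move=> om; apply/measurable_EFinP; apply: measurable_funM.
rewrite ExE -sumEFin; apply: eq_bigr => om _.
under eq_integral do rewrite EFinM.
rewrite ge0_integralZl//; first last.
- by rewrite lee_fin.
- by apply/measurable_EFinP; exact: measurable_indic.
by rewrite integral_indic// setIT muleC EFinM; congr (_ * _)%E; exact: P_evs.
Qed.

End finite_law.

Section discretized_moments.
Context d dU (T : measurableType d) (U : measurableType dU) (R : realType).
Context (P : probability T R) (n : nat) (X : 'I_n -> {RV P >-> U}).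
Context (g : nat -> U -> R).
Hypothesis mg : forall j, measurable_fun setT (g j).
Hypothesis indepX : independent_RVs X.
Context (m : nat).
Hypothesis m0 : (0 < m)%N.
Local Notation A := {ffun 'I_m -> bool * 'I_(m * m).+1}.
Local Notation Om := {ffun 'I_n -> A}.

Let cell (u : U) : A := [ffun j : 'I_m => quant_code m (g j u)].

Let cell_meas a : measurable (cell @^-1` [set a]).
Proof.
rewrite (_ : _ @^-1` _ = \bigcap_(j in [set` [set: 'I_m]%SET])
    (g j @^-1` [set x | quant_code m x = a j])).
  apply: fin_bigcap_measurable => // j _; rewrite -[X in measurable X]setTI.
  by apply: mg => //; exact: measurable_quant_code.
apply/seteqP; split => [u <- j _|u uP] /=; first by rewrite ffunE.
by apply/ffunP => j; rewrite ffunE; apply: uP; rewrite /= inE.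
Qed.

Let mu := cell_law X cell.
Let mu0 := cell_law_ge0 X cell.
Let mu1 := cell_law_sum X cell_meas.

Let entries (om : Om) (i : 'I_n) (j : 'I_m) : R := quant_value (om i j).
Let h om := rad_avg (entries om).
Let hk k om := rad_avg (drop_row k (entries om)).
Let Mx om : R := \big[Num.max/0]_i max_abs (entries om i).

Let Mx_ge0 om : 0 <= Mx om.
Proof. exact: bigmax_ge_id. Qed.

Let hk_M k om : h om - hk k om <= Mx om.
Proof.
apply: rad_avg_drop_ge => // j; apply: (le_trans (le_max_abs _ j)).
exact: (le_bigmax 0 (fun i => max_abs (entries om i)) k).
Qed.

Let hk_free k : free_of k (hk k).
Proof.
move=> om a; congr rad_avg; apply/funext => i; apply/funext => j.
by rewrite /drop_row /entries ffunE; case: eqP.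
Qed.

Definition quant_avg (w : T) : R := quant_rad g m (fun i => X i w).

Let quant_avgE w : quant_avg w = h (cells X cell w).
Proof.
by congr rad_avg; apply/funext => i; apply/funext => j; rewrite /entries !ffunE.
Qed.

Definition quant_mean : R := Ex mu h.

Lemma measurable_quant_avg : measurable_fun setT quant_avg.
Proof. by rewrite (funext quant_avgE); exact: measurable_cells. Qed.

Lemma integral_quant_avg : (\int[P]_w (quant_avg w)%:E = quant_mean%:E)%E.
Proof.
rewrite -integral_cells//; first by apply: eq_integral => w _; rewrite quant_avgE.
by move=> om; exact: rad_avg_ge0.
Qed.

Variables (M : T -> \bar R) (q a : R).
Hypotheses (mM : measurable_fun setT M) (M0 : forall w, (0 <= M w)%E).
Hypothesis gM : forall w i j, (`|g j (X i w)|%:E <= M w)%E.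
Hypotheses (q2 : 2 <= q) (a0 : 0 < a).
Hypothesis Ma : (\int[P]_w (M w `^ q) <= (a `^ q)%:E)%E.

(** The quantized envelope stays below M because rounding is towards 0. *)
Let Mx_le w : ((Mx (cells X cell w))%:E <= M w)%E.
Proof.
rewrite /Mx -EFin_bigmax; apply/bigmax_leP; split => // i _.
rewrite /max_abs -EFin_bigmax; apply/bigmax_leP; split => // j _.
apply: le_trans (gM w i j); rewrite lee_fin /entries !ffunE.
exact: normr_quant_le.
Qed.

Let Ex_Mx : Ex mu (fun om => Mx om `^ q) <= a `^ q.
Proof.
have q0 : 0 <= q := le_trans (ler0n R 2) q2.
rewrite -lee_fin -integral_cells//; last by move=> om; exact: powR_ge0.
apply: le_trans Ma; apply: ge0_le_integral => //.
- by move=> w _; rewrite lee_fin powR_ge0.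
- apply/measurable_EFinP.
  exact: (measurable_cells X cell_meas (fun om => Mx om `^ q)).
- exact: measurableT_comp (measurable_poweR _) mM.
move=> w _; rewrite -poweR_EFin; apply: gt0_ler_poweR => //.
  by rewrite in_itv/= lee_fin Mx_ge0 leey.
by rewrite in_itv/= M0 leey.
Qed.

Let nrm_bound (f : Om -> R) (F : T -> R) b : (forall om, 0 <= f om) ->
  (forall w, F w = f (cells X cell w)) -> 0 <= b ->
  nrm mu q f <= b -> (\int[P]_w (F w `^ q)%:E <= (b `^ q)%:E)%E.
Proof.
move=> f0 Ff b0 fb; have q0 : 0 < q by exact: lt_le_trans q2.
under eq_integral do rewrite Ff.
rewrite (integral_cells cell_meas indepX (fun om => powR_ge0 (f om) q)) lee_fin.
rewrite -(nrm_powR mu0 f (lt0r_neq0 q0)).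
by apply: ge0_ler_powR; rewrite ?nnegrE ?nrm_ge0// ltW.
Qed.

Let hk0 k om : 0 <= hk k om. Proof. exact: rad_avg_ge0. Qed.
Let hk_le k om : hk k om <= h om. Proof. exact: rad_avg_drop_le. Qed.
Let hk_sum om : \sum_k (h om - hk k om) <= h om. Proof. exact: rad_avg_drop_sum. Qed.

Lemma quant_mean_ge0 : 0 <= quant_mean.
Proof. by apply: Ex_ge0 => // om; exact: rad_avg_ge0. Qed.

Lemma quant_upper_moment :
  (\int[P]_w (Num.max (quant_avg w - quant_mean) 0 `^ q)%:E <=
   ((Num.sqrt (kappa R * q * a * quant_mean) + kappa R * q * a) `^ q)%:E)%E.
Proof.
have := up_moment mu0 mu1 Mx_ge0 hk0 hk_le hk_M hk_sum hk_free q2 a0 Ex_Mx.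
apply: nrm_bound => [om|w|].
- by rewrite le_max lexx orbT.
- by rewrite quant_avgE.
- rewrite addr_ge0 ?sqrtr_ge0//.
  exact: mulr_ge0 (mulr_ge0 (ltW (@kappa_gt0 R)) (le_trans (ler0n R 2) q2)) (ltW a0).
Qed.

Lemma quant_lower_moment :
  (\int[P]_w (Num.max (quant_mean - quant_avg w) 0 `^ q)%:E <=
   ((2 * (Num.sqrt (q * a * quant_mean) + 2 * (q * a))) `^ q)%:E)%E.
Proof.
have := dn_moment mu0 mu1 Mx_ge0 hk0 hk_le hk_M hk_sum hk_free q2 a0 Ex_Mx.
apply: nrm_bound => [om|w|].
- by rewrite le_max lexx orbT.
- by rewrite quant_avgE.
- by rewrite mulr_ge0// addr_ge0 ?sqrtr_ge0// !mulr_ge0 ?(ltW a0) ?(le_trans _ q2).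
Qed.

End discretized_moments.
(** * The conditional expectation as an average over signs *)

Section sigma_RVs_theory.
Context d dU (T : measurableType d) (U : measurableType dU) (R : realType).
Context (P : probability T R) (n : nat) (X : 'I_n -> {RV P >-> U}).

Lemma sigma_RVs_sigma_algebra : sigma_algebra setT (sigma_RVs X).
Proof. exact: smallest_sigma_algebra. Qed.

Lemma sigma_RVs_preimage i B : measurable B -> sigma_RVs X (X i @^-1` B).
Proof.
move=> mB; apply: sub_sigma_algebra; rewrite (bigD1 i)//=; left.
by exists B => //; rewrite setTI.
Qed.

Lemma sigma_RVs_measurable : sigma_RVs X `<=` measurable.
Proof.
apply: smallest_sub; first exact: sigma_algebra_measurable.
apply: (big_ind (fun C => C `<=` d.-measurable)) => [C //|C D mC mD|i _].
  by rewrite subUset; split.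
by move=> _ [B mB <-]; exact: measurable_funP.
Qed.

Lemma measurable_sigma_RVs i :
  measurable_fun [set: g_sigma_algebraType (sigma_RVs X)] (X i).
Proof.
by apply: measurable_fun_sub => [|B]; [exact: sigma_RVs_sigma_algebra|exact: sigma_RVs_preimage].
Qed.

Lemma sigma_RVs_bigcap (D : {set 'I_n}) (B : 'I_n -> set U) :
  (forall i, measurable (B i)) ->
  sigma_RVs X (\bigcap_(i in [set` D]) (X i @^-1` B i)).
Proof.
move=> mB; rewrite -(measurable_sub sigma_RVs_sigma_algebra).
apply: fin_bigcap_measurable => // i _.
by rewrite measurable_sub; [exact: sigma_RVs_preimage|exact: sigma_RVs_sigma_algebra].
Qed.

End sigma_RVs_theory.

Section sign_average.
Context d dU (T : measurableType d) (U : measurableType dU) (R : realType).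
Context (P : probability T R) (n : nat) (X : 'I_n -> {RV P >-> U}).
Context (eps : 'I_n -> {RV P >-> R}) (g : nat -> U -> R).
Hypothesis mg : forall j, measurable_fun setT (g j).
Hypotheses (indep_eps : independent_RVs eps) (rad_eps : forall i, rademacher (eps i)).
Hypothesis indep_eps_X : independent_pair P (sigma_RVs eps) (sigma_RVs X).
Implicit Type s : {ffun 'I_n -> bool}.

Let sign_event s : set T :=
  \bigcap_(i in [set` [set: 'I_n]%SET]) (eps i @^-1` [set sgn (s i)]).

Let sign_event_sigma s : sigma_RVs eps (sign_event s).
Proof. by apply: (sigma_RVs_bigcap (X := eps) [set: 'I_n]%SET (B := fun i => [set sgn (s i)])). Qed.

Let measurable_sign_event s : measurable (sign_event s).
Proof. exact: (@sigma_RVs_measurable _ _ _ _ _ P n eps). Qed.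

Let P_sign_event s : P (sign_event s) = (2^-1 ^+ #|'I_n|)%:E.
Proof.
rewrite indep_eps; last first.
  by move=> i _; exists [set sgn (s i)]; rewrite ?setTI.
rewrite -(@prodr_const _ 'I_n predT) -prodEFin; apply: eq_big => [i|i _]; first by rewrite inE.
have [e1 eN1] := rad_eps i.
by rewrite /sgn; case: (s i); rewrite ?expr1 ?expr0.
Qed.

Let integral_sign_event s (f : T -> \bar R) A :
  (forall w, (0 <= f w)%E) -> (forall B, measurable B -> sigma_RVs X (f @^-1` B)) ->
  sigma_RVs X A ->
  (\int[P]_(w in A) (f \_ (sign_event s)) w =
   (2^-1 ^+ #|'I_n|)%:E * \int[P]_(w in A) f w)%E.
Proof.
move=> f0 fX AX; rewrite -integral_mkcondr.
have c0 : 0 <= 2^-1 ^+ #|'I_n| :> R by [].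
pose c := NngNum c0.
apply: (ge0_integral_indep (sigma_RVs_sigma_algebra X)
  (@sigma_RVs_measurable _ _ _ _ _ P n X) (c := c)) => // B BX.
have := indep_eps_X (sign_event_sigma s) BX.
by rewrite P_sign_event setIC.
Qed.

Let signs_ae : \forall w \ae P, forall i, eps i w = 1 \/ eps i w = -1.
Proof.
apply: filter_forall => i.
have m1 (x : R) : measurable (eps i @^-1` [set x]).
  by rewrite -[X in measurable X]setTI; exact: measurable_funP.
exists (~` (eps i @^-1` [set 1] `|` eps i @^-1` [set -1])); split.
- by apply: measurableC; exact: measurableU.
- have disj : eps i @^-1` [set 1] `&` eps i @^-1` [set -1] = set0.
    rewrite -subset0 => w [/= -> /eqP]; rewrite -subr_eq0 opprK.
    by rewrite -[1 + 1]/(2%:R) pnatr_eq0.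
  have [e1 eN1] := rad_eps i.
  have m2 : measurable (eps i @^-1` [set 1] `|` eps i @^-1` [set -1]) by exact: measurableU.
  have PU : P (eps i @^-1` [set 1] `|` eps i @^-1` [set -1]) = 1%:E.
    transitivity (P (eps i @^-1` [set 1%R]) + P (eps i @^-1` [set (-1)%R]))%E.
      exact: measureU.
    by rewrite e1 eN1 -EFinD; congr EFin; lra.
  by apply: (etrans (probability_setC P m2)); rewrite PU subee.
- by move=> w /=; apply: contra_not => -[]; [left|right].
Qed.

Let ran_S w : rademacher_sup (range g) eps X w =
  ereal_sup (range (fun j => `|\sum_i eps i w * g j (X i w)|%:E)).
Proof.
congr ereal_sup; apply/seteqP; split => [_ [_ [j _ <-] <-]|_ [j _ <-]].
  by exists j.
by exists (g j) => //; exists j.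
Qed.

Lemma rademacher_sup_ge0 w : (0 <= rademacher_sup (range g) eps X w)%E.
Proof.
rewrite ran_S; apply: le_trans (ereal_sup_ubound _); last by exists 0%N.
by rewrite lee_fin.
Qed.

Lemma measurable_rademacher_sup : measurable_fun setT (rademacher_sup (range g) eps X).
Proof.
pose f j w := `|\sum_i eps i w * g j (X i w)|%:E.
rewrite (_ : rademacher_sup _ _ _ = (fun w => esups (f ^~ w) 0)); last first.
  apply/funext => w; rewrite ran_S /esups /=; congr ereal_sup.
  by apply/seteqP; split => _ [j _ <-]; exists j.
apply: measurable_fun_esups => j; apply/measurable_EFinP.
apply: measurableT_comp => //; apply: measurable_sum => i.
by apply: measurable_funM => //; exact: measurableT_comp (mg j) _.
Qed.

Let sup_sum_X s w := sup_sum g s (fun i => X i w).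

Let sup_sum_sigma s B : measurable B -> sigma_RVs X (sup_sum_X s @^-1` B).
Proof.
move=> mB; rewrite -(measurable_sub (sigma_RVs_sigma_algebra X)).
have := @measurable_sup_sum R _ _ (g_sigma_algebraType (sigma_RVs X)) U n g
  (fun i => X i) s mg (@measurable_sigma_RVs _ _ _ _ _ P n X).
by move=> /(_ measurableT B mB); rewrite setTI.
Qed.

Lemma cond_rad_sigma B : measurable B ->
  sigma_RVs X ((fun w => cond_rad g (fun i => X i w)) @^-1` B).
Proof.
move=> mB; rewrite -(measurable_sub (sigma_RVs_sigma_algebra X)).
have := @measurable_cond_rad R _ _ (g_sigma_algebraType (sigma_RVs X)) U n g
  (fun i => X i) mg (@measurable_sigma_RVs _ _ _ _ _ P n X).
by move=> /(_ measurableT B mB); rewrite setTI.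
Qed.

Let rademacher_sup_ae : ae_eq P setT (rademacher_sup (range g) eps X)
  (fun w => \sum_s (sup_sum_X s \_ (sign_event s)) w)%E.
Proof.
apply: filterS signs_ae => w ew _.
pose s0 : {ffun 'I_n -> bool} := [ffun i => eps i w == -1].
have es0 i : eps i w = sgn (s0 i).
  rewrite ffunE /sgn; case: (ew i) => ->; last by rewrite eqxx expr1.
  by rewrite -subr_eq0 opprK -[1 + 1]/(2%:R) pnatr_eq0 expr0.
rewrite (bigD1 s0)//= big1 ?adde0.
  rewrite patchE mem_set; last by move=> i _; rewrite /= es0.
  rewrite ran_S /sup_sum_X /sup_sum; congr (ereal_sup (_ @` _)).
  apply/funext => j; congr (`|_|%:E); apply: eq_bigr => i _.
  by rewrite es0.
move=> s ns; rewrite patchE memNset// => /= sw; move/eqP: ns; apply.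
apply/ffunP => i; have : eps i w = sgn (s i) by apply: sw; rewrite /= inE.
rewrite es0 /sgn; case: (s i); case: (s0 i); rewrite ?expr0 ?expr1//.
  by move/eqP; rewrite -subr_eq0 opprK -[1 + 1]/(2%:R) pnatr_eq0.
by move/esym/eqP; rewrite -subr_eq0 opprK -[1 + 1]/(2%:R) pnatr_eq0.
Qed.

(** Almost surely the signs equal exactly one sign vector s.  On that event
the supremum is the function [sup_sum] of s and X, and the event has
probability 2^-n independently of X. *)
Lemma integral_cond_rad A : sigma_RVs X A ->
  (\int[P]_(w in A) rademacher_sup (range g) eps X w =
   \int[P]_(w in A) cond_rad g (fun i => X i w))%E.
Proof.
move=> AX; have mA : measurable A by exact: (@sigma_RVs_measurable _ _ _ _ _ P n X).
have mss s : measurable_fun setT (sup_sum_X s).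
  by apply: measurable_sup_sum => // i; exact: measurable_funP.
have ss0 s w : (0 <= sup_sum_X s w)%E by exact: sup_sum_ge0.
have msE s : measurable_fun A (sup_sum_X s \_ (sign_event s)).
  apply: measurable_funTS; apply/(measurable_restrict _ (measurable_sign_event s) measurableT).
  exact: measurable_funTS.
have sE0 s w : (0 <= (sup_sum_X s \_ (sign_event s)) w)%E.
  by rewrite patchE; case: ifP.
rewrite (ge0_ae_eq_integral mA _ _ _ _ (ae_eq_subset _ rademacher_sup_ae))//; first last.
- by move=> w _; exact: sume_ge0.
- by move=> w _; exact: rademacher_sup_ge0.
- exact: emeasurable_sum.
- by apply: measurable_funTS; exact: measurable_rademacher_sup.
rewrite ge0_integral_sum//.
have eqs s : (\int[P]_(w in A) (sup_sum_X s \_ (sign_event s)) w =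
    (2^-1 ^+ #|'I_n|)%:E * \int[P]_(w in A) sup_sum_X s w)%E.
  by rewrite integral_sign_event//; exact: sup_sum_sigma.
under eq_bigr do rewrite eqs.
rewrite -ge0_sume_distrr; last by move=> s _; exact: integral_ge0.
rewrite -ge0_integral_sum//; last by move=> s; exact: measurable_funTS.
rewrite -ge0_integralZl//.
- by apply: measurable_funTS; exact: emeasurable_sum.
- by move=> w _; exact: sume_ge0.
Qed.

End sign_average.

(** * Passage to the limit *)

(** The bounds l^q + e and max(l^q - e, 0) are themselves q-th powers, for
l > 0 of numbers on either side of l. *)
Lemma cvg_powR {R : realType} (x : nat -> R) (l q : R) : 0 < q -> 0 <= l ->
  (forall m, 0 <= x m) -> x m @[m --> \oo] --> l -> x m `^ q @[m --> \oo] --> l `^ q.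
Proof.
move=> q0 l0 x0 xl; have qn := lt0r_neq0 q0.
have qV : 0 < q^-1 by rewrite invr_gt0.
apply/cvgrPdist_le => e e0.
have le0 : 0 <= l `^ q + e by rewrite addr_ge0 ?powR_ge0 ?ltW.
pose b := (l `^ q + e) `^ q^-1; pose c := (Num.max (l `^ q - e) 0) `^ q^-1.
have c0 : 0 <= Num.max (l `^ q - e) 0 by rewrite le_max lexx orbT.
have lb : l < b.
  rewrite -[ltLHS](root_powRK l0 qn); apply: gt0_ltr_powR; rewrite ?nnegrE ?powR_ge0//.
  by rewrite ltrDl.
have cl : l = 0 \/ c < l.
  have [->|ln0] := eqVneq l 0; [by left|right].
  have lq0 : 0 < l `^ q by rewrite powR_gt0// lt_neqAle eq_sym ln0.
  rewrite -[ltRHS](root_powRK l0 qn); apply: gt0_ltr_powR; rewrite ?nnegrE ?powR_ge0//.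
  by rewrite gt_max lq0 andbT gtrBl.
have up : \forall m \near \oo, x m `^ q <= l `^ q + e.
  near=> m; have /ltW xb : x m < b by near: m; exact: (cvgr_lt l).
  rewrite -(powR_rootK le0 qn).
  by apply: (ge0_ler_powR (ltW q0)); rewrite ?nnegrE ?powR_ge0.
have low : \forall m \near \oo, l `^ q - e <= x m `^ q.
  case: cl => [->|cl]; near=> m.
    by rewrite powR0// (le_trans _ (powR_ge0 _ _))// sub0r oppr_le0 ltW.
  have /ltW xb : c < x m by near: m; exact: (cvgr_gt l).
  have : Num.max (l `^ q - e) 0 <= x m `^ q.
    rewrite -(powR_rootK c0 qn).
    by apply: (ge0_ler_powR (ltW q0)); rewrite ?nnegrE ?powR_ge0.
  by rewrite ge_max => /andP[].
near=> m; rewrite distrC ler_norml lerBlDr [e + _]addrC (near up m)//=.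
by rewrite lerBrDl (near low m).
Unshelve. all: by end_near. Qed.

Section Lnorm_limit.
Context d (T : measurableType d) (R : realType) (P : probability T R).
Local Open Scope ereal_scope.

(** Dominated convergence for the q-th powers. *)
Lemma Lnorm_limit (q b : R) (f : T -> \bar R) (D : nat -> T -> R) (H : T -> \bar R) :
  (0 < q)%R -> (0 <= b)%R -> measurable_fun setT f ->
  (forall m, measurable_fun setT (D m)) -> (forall m w, (0 <= D m w)%R) ->
  P.-integrable setT H ->
  (\forall w \ae P, forall m, (D m w `^ q)%:E <= H w) ->
  (\forall w \ae P, exists2 l : R, `|f w| = l%:E & D m w @[m --> \oo] --> l) ->
  (\forall m \near \oo, \int[P]_w (D m w `^ q)%:E <= (b `^ q)%:E) ->
  'N[P]_(q%:E)[f] <= b%:E.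
Proof.
move=> q0 b0 mf mD D0 iH DH Df Db; have qn := lt0r_neq0 q0.
have [||||_ _ cI] := @dominated_convergence _ _ _ P _ measurableT
  (fun m w => (D m w `^ q)%:E) (fun w => `|f w| `^ q) H _ _ _ iH.
- move=> m; apply/measurable_EFinP.
  by apply: (measurableT_comp (measurable_powR q)); exact: mD.
- by apply: measurableT_comp (measurable_poweR _) _; exact: measurableT_comp.
- apply: filterS Df => w [l fl Dl] _; rewrite fl poweR_EFin.
  apply/cvg_EFin; first by near=> m.
  apply: cvg_powR => //; rewrite -lee_fin -fl; exact: abse_ge0.
- by apply: filterS DH => w Hw m _; rewrite gee0_abs ?lee_fin ?powR_ge0.
have Ib : \int[P]_w (`|f w| `^ q) <= (b `^ q)%:E by exact: (cvge_to_le cI).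
rewrite unlock /Lnorm -(root_powRK b0 qn) -poweR_EFin.
apply: gt0_ler_poweR => //; first by rewrite invr_ge0 ltW.
- by rewrite in_itv/= leey andbT integral_ge0// => w _; exact: poweR_ge0.
- by rewrite in_itv/= leey andbT lee_fin powR_ge0.
Unshelve. all: by end_near. Qed.

End Lnorm_limit.

(** The approximations satisfy the moment bounds with their own means, which
are only eventually below z + t, and with a positive bound a + t on the norm of
the envelope; then t tends to 0. *)
Lemma le_of_perturbed (R : realType) (x : \bar R) (c e k a z : R) : 0 <= c -> 0 <= e ->
  (forall t : R, 0 < t ->
    (x <= (k * (Num.sqrt (c * (a + t) * (z + t)) + e * (a + t)))%:E)%E) ->
  (x <= (k * (Num.sqrt (c * a * z) + e * a))%:E)%E.
Proof.
move=> c0 e0 xF; pose F (t : R) := k * (Num.sqrt (c * (a + t) * (z + t)) + e * (a + t)).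
have F0 : F t @[t --> 0^'+] --> F 0.
  have idc (y : R) : y + t @[t --> 0^'+] --> y + 0.
    apply: cvgD; first exact: cvg_cst.
    by apply: cvg_at_right_filter; exact: cvg_id.
  rewrite /F; apply: cvgMr; apply: cvgD; last by apply: cvgMr; exact: idc.
  apply: continuous_cvg; first exact: sqrt_continuous.
  by apply: cvgM (idc z); apply: cvgMr; exact: idc.
rewrite (_ : k * _ = F 0); last by rewrite /F !addr0.
apply/lee_addgt0Pr => r r0.
have Fr : \forall t \near 0^'+, F t < F 0 + r by apply: (cvgr_lt (F 0)) => //; rewrite ltrDl.
near (0:R)^'+ => t.
have t0 : 0 < t by near: t; exact: nbhs_right_gt.
apply: (le_trans (xF _ t0)); rewrite -EFinD lee_fin ltW//.
by near: t.
Unshelve. all: by end_near. Qed.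

Lemma cvg_max0 (R : realType) (x : nat -> R) (l : R) :
  x m @[m --> \oo] --> l -> Num.max (x m) 0 @[m --> \oo] --> Num.max l 0.
Proof.
move=> xl; have e (y : R) : Num.max y 0 = 2^-1 * (y + `|y|).
  by case: (lerP 0 y) => y0; [rewrite ger0_norm|rewrite ltr0_norm]; lra.
under eq_cvg do rewrite e; rewrite e.
by apply: cvgMr; apply: cvgD => //; exact: cvg_norm.
Qed.

Section limit_moments.
Context d dU (T : measurableType d) (U : measurableType dU) (R : realType).
Context (P : probability T R) (n : nat) (X : 'I_n -> {RV P >-> U}).
Context (g : nat -> U -> R).
Hypothesis mg : forall j, measurable_fun setT (g j).
Hypothesis indepX : independent_RVs X.
Variables (M : T -> \bar R) (q a : R).
Hypotheses (mM : measurable_fun setT M) (M0 : forall w, (0 <= M w)%E).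
Hypothesis gM : forall w i j, (`|g j (X i w)|%:E <= M w)%E.
Hypotheses (q2 : 2 <= q) (a0 : 0 <= a).
Hypothesis Ma : (\int[P]_w (M w `^ q) <= (a `^ q)%:E)%E.

Let V w := cond_rad g (fun i => X i w).
Let W m := quant_avg X g m.+1.
Let zm m := quant_mean X g m.+1.

Let q0 : 0 < q. Proof. exact: lt_le_trans q2. Qed.

Let iMq : P.-integrable setT (fun w => M w `^ q)%E.
Proof.
apply/integrableP; split; first exact: measurableT_comp (measurable_poweR _) mM.
rewrite (eq_integral (fun w => M w `^ q)%E); first exact: le_lt_trans Ma (ltry _).
by move=> w _; rewrite gee0_abs// poweR_ge0.
Qed.

Let iM : P.-integrable setT M.
Proof.
have i1 : P.-integrable setT (cst 1%E : T -> \bar R) by exact: finite_measure_integrable_cst.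
apply: le_integrable (integrableD measurableT i1 iMq) => // w _.
rewrite !gee0_abs ?adde_ge0 ?poweR_ge0//; move: (M0 w).
case: (M w) => [r| |]; last by [].
- rewrite lee_fin => r0; rewrite poweR_EFin -EFinD lee_fin.
  have [r1|r1] := leP r 1; first by rewrite (le_trans r1)// lerDl powR_ge0.
  apply: (@le_trans _ _ (r `^ q)); last by rewrite lerDr.
  by rewrite -{1}(powRr1 r0) ler_powR ?(ltW r1)// (le_trans _ q2)// ler1n.
- by rewrite poweRyr ?gt_eqF.
Qed.

Let M_fin : \forall w \ae P, M w \is a fin_num.
Proof. by apply: filterS (integrable_ae measurableT iM) => w; apply. Qed.

Let gMfin w : M w \is a fin_num -> forall i j, `|g j (X i w)| <= fine (M w).
Proof. by move=> Mf i j; rewrite -lee_fin fineK. Qed.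

Let W_le w m : M w \is a fin_num -> W m w <= n%:R * fine (M w).
Proof. by move=> Mf; apply: quant_rad_le; [|exact: fine_ge0|exact: gMfin]. Qed.

Let cvg_W w : M w \is a fin_num ->
  V w \is a fin_num /\ W m w @[m --> \oo] --> fine (V w).
Proof.
move=> /gMfin gB; have [Vf WV] := quant_rad_cvg gB; split => //.
by rewrite /W /quant_avg (cvg_shiftS (fun m => quant_rad g m (fun i => X i w))).
Qed.

Let mV : measurable_fun setT V.
Proof. by apply: measurable_cond_rad => // i; exact: measurable_funP. Qed.

Let zmE m : (\int[P]_w (W m w)%:E)%E = (zm m)%:E.
Proof. exact: integral_quant_avg. Qed.

Let limit_law : P.-integrable setT V /\ (zm m)%:E @[m --> \oo] --> (\int[P]_w V w)%E.
Proof.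
have inM : P.-integrable setT (fun w => n%:R%:E * M w)%E by exact: integrableZl.
have [||||iV _ cI] := @dominated_convergence _ _ _ P _ measurableT
  (fun m w => (W m w)%:E) V _ _ _ _ inM.
- by move=> m; apply/measurable_EFinP; exact: measurable_quant_avg.
- exact: mV.
- apply: filterS M_fin => w /cvg_W[Vf WV] _; rewrite -(fineK Vf).
  by apply/cvg_EFin => //; near=> m.
- apply: filterS M_fin => w Mf m _; rewrite gee0_abs ?lee_fin ?quant_rad_ge0//.
  by rewrite -(fineK Mf) -EFinM lee_fin W_le.
by split => //; rewrite (funext (fun m => esym (zmE m))).
Unshelve. all: by end_near. Qed.

Lemma integrable_cond_rad : P.-integrable setT V.
Proof. by case: limit_law. Qed.

Let z := fine (\int[P]_w V w)%E.

Let zE : (\int[P]_w V w)%E = z%:E.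
Proof. by rewrite fineK// integrable_fin_num//; exact: integrable_cond_rad. Qed.

Let z0 : 0 <= z.
Proof. by apply: fine_ge0; apply: integral_ge0 => w _; exact: cond_rad_ge0. Qed.

Let cvg_zm : zm m @[m --> \oo] --> z.
Proof. by have := limit_law.2; rewrite zE => /fine_cvgP[]. Qed.

Variable Z : T -> \bar R.
Hypothesis mZ : measurable_fun setT Z.
Hypothesis ZV : ae_eq P setT V Z.

Let EZ : (\int[P]_w Z w)%E = z%:E.
Proof.
by rewrite -zE; apply/esym/ae_eq_integral.
Qed.

Let Z_ae : \forall w \ae P, [/\ M w \is a fin_num, V w \is a fin_num & Z w = (fine (V w))%:E].
Proof.
apply: filterS2 M_fin ZV => w Mf /(_ I) <-.
by have [Vf _] := cvg_W Mf; rewrite fineK.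
Qed.

Let Ma_le t : 0 < t -> (\int[P]_w (M w `^ q) <= ((a + t) `^ q)%:E)%E.
Proof.
move=> t0; apply: (le_trans Ma); rewrite lee_fin.
by apply: (ge0_ler_powR (ltW q0)); rewrite ?nnegrE ?addr_ge0 ?lerDl// ltW.
Qed.

Let at0 t : 0 < t -> 0 < a + t.
Proof. by move=> t0; apply: ltr_wpDl. Qed.

Let mW m : measurable_fun setT (W m).
Proof. exact: measurable_quant_avg. Qed.

(** The q-th powers of the positive parts are dominated by (n M)^q. *)
Lemma upper_moment_limit :
  ('N[P]_(q%:E)[(fun w => Z w - \int[P]_w Z w)^\+] <=
   (1 * (Num.sqrt (kappa R * q * a * z) + kappa R * q * a))%:E)%E.
Proof.
have kq0 : 0 <= kappa R * q := mulr_ge0 (ltW (@kappa_gt0 R)) (ltW q0).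
rewrite EZ; apply: le_of_perturbed => // t t0; rewrite mul1r.
have nq0 : (0 <= (n%:R `^ q)%:E :> \bar R)%E by rewrite lee_fin powR_ge0.
apply: (@Lnorm_limit _ _ _ P q _ _ (fun m w => Num.max (W m w - zm m) 0)
  (fun w => (n%:R `^ q)%:E * M w `^ q)%E) => //.
- by rewrite addr_ge0 ?sqrtr_ge0// mulr_ge0// ltW// at0.
- by apply: measurable_funepos; apply: emeasurable_funB.
- by move=> m; apply: measurable_maxr => //; exact: measurable_funB.
- by move=> m w; rewrite le_max lexx orbT.
- exact: integrableZl.
- apply: filterS M_fin => w Mf m; rewrite -(fineK Mf) poweR_EFin -EFinM lee_fin.
  rewrite -powRM ?fine_ge0//; apply: (ge0_ler_powR (ltW q0)); rewrite ?nnegrE.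
  + by rewrite le_max lexx orbT.
  + by rewrite mulr_ge0// fine_ge0.
  rewrite ge_max mulr_ge0 ?fine_ge0// andbT lerBlDr (le_trans (W_le m Mf))// lerDl.
  exact: quant_mean_ge0.
- apply: filterS Z_ae => w [/cvg_W[_ WV] Vf Zw]; exists (Num.max (fine (V w) - z) 0).
    rewrite funeposE Zw -EFinB -EFin_max gee0_abs//.
    by rewrite lee_fin le_max lexx orbT.
  by apply: cvg_max0; apply: cvgB.
have zt : \forall m \near \oo, zm m < z + t by apply: (cvgr_lt z) => //; rewrite ltrDl.
apply: filterS zt => m /ltW zt.
apply: le_trans (quant_upper_moment mg indepX (ltn0Sn m) mM M0 gM q2 (at0 t0) (Ma_le t0)) _.
have kt0 : 0 <= kappa R * q * (a + t) := mulr_ge0 kq0 (ltW (at0 t0)).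
rewrite lee_fin; apply: (ge0_ler_powR (ltW q0)); rewrite ?nnegrE.
- exact: addr_ge0 (sqrtr_ge0 _) kt0.
- exact: addr_ge0 (sqrtr_ge0 _) kt0.
by rewrite lerD2r; apply: ler_wsqrtr; exact: ler_wpM2l.
Qed.

(** The negative parts are dominated by a bound on the means, because the
averages are nonnegative. *)
Lemma lower_moment_limit :
  ('N[P]_(q%:E)[(fun w => Z w - \int[P]_w Z w)^\-] <=
   (2 * (Num.sqrt (q * a * z) + (2 * q) * a))%:E)%E.
Proof.
rewrite EZ; apply: le_of_perturbed => [||t t0]; rewrite ?mulr_ge0 ?(ltW q0)//.
have qt0 : 0 <= q * (a + t) := mulr_ge0 (ltW q0) (ltW (at0 t0)).
have b0 (y : R) : 0 <= 2 * (Num.sqrt y + 2 * q * (a + t)).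
  by rewrite mulr_ge0// addr_ge0 ?sqrtr_ge0// -mulrA mulr_ge0.
have zt : \forall m \near \oo, zm m < z + t by apply: (cvgr_lt z) => //; rewrite ltrDl.
have [K K0 zK] : exists2 K : R, 0 <= K & forall m, zm m <= K.
  have [K [_ zK]] : bounded_fun zm by apply: cvg_seq_bounded; apply/cvg_ex; exists z.
  exists (`|K| + 1) => [|m]; first by rewrite addr_ge0.
  apply: le_trans (ler_norm _) _; apply: zK => //.
  by rewrite (le_lt_trans (ler_norm K))// ltrDl.
apply: (@Lnorm_limit _ _ _ P q _ _ (fun m w => Num.max (zm m - W m w) 0)
  (cst (K `^ q)%:E)) => //.
- by apply: measurable_funeneg; apply: emeasurable_funB.
- by move=> m; apply: measurable_maxr => //; exact: measurable_funB.
- by move=> m w; rewrite le_max lexx orbT.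
- exact: finite_measure_integrable_cst.
- apply: filterS M_fin => w Mf m; rewrite lee_fin.
  apply: (ge0_ler_powR (ltW q0)); rewrite ?nnegrE//.
  + by rewrite le_max lexx orbT.
  rewrite ge_max K0 andbT lerBlDr (le_trans (zK m))// lerDl.
  exact: quant_rad_ge0.
- apply: filterS Z_ae => w [/cvg_W[_ WV] Vf Zw]; exists (Num.max (z - fine (V w)) 0).
    rewrite funenegE Zw -EFinB -EFinN opprB -EFin_max gee0_abs//.
    by rewrite lee_fin le_max lexx orbT.
  by apply: cvg_max0; apply: cvgB.
apply: filterS zt => m /ltW zt.
apply: le_trans (quant_lower_moment mg indepX (ltn0Sn m) mM M0 gM q2 (at0 t0) (Ma_le t0)) _.
rewrite mulrA lee_fin; apply: (ge0_ler_powR (ltW q0)); rewrite ?nnegrE//.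
rewrite ler_pM2l// lerD2r; apply: ler_wsqrtr; exact: ler_wpM2l.
Qed.

End limit_moments.

(** * The envelope and the moment inequalities *)

Section envelope_theory.
Context d dU (T : measurableType d) (U : measurableType dU) (R : realType).
Context (n : nat) (X : 'I_n -> T -> U).

Lemma le_envelope (F : set (U -> R)) f i w : F f -> (`|f (X i w)|%:E <= envelope F X w)%E.
Proof. by move=> Ff; apply: ereal_sup_ubound; exists i => //; exists f. Qed.

Lemma envelope_ge0 (F : set (U -> R)) w : (0 < n)%N -> F !=set0 -> (0 <= envelope F X w)%E.
Proof.
move=> n0 [f Ff]; apply: le_trans (le_envelope (Ordinal n0) w Ff).
by rewrite lee_fin.
Qed.

Lemma measurable_envelope (g : nat -> U -> R) : (0 < n)%N ->
  (forall j, measurable_fun setT (g j)) -> (forall i, measurable_fun setT (X i)) ->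
  measurable_fun setT (envelope (range g) X).
Proof.
move=> n0 mg mX.
(* The index k = j * n + i stands for the pair (i, j), so that the supremum runs over nat. *)
pose f k w := `|g (k %/ n)%N (X (Ordinal (ltn_pmod k n0)) w)|%:E.
rewrite (_ : envelope _ _ = (fun w => esups (f ^~ w) 0)); last first.
  apply/funext => w; rewrite /esups /=; congr ereal_sup.
  apply/seteqP; split => [_ [i _ [_ [j _ <-] <-]]|_ [k _ <-]]; last first.
    by exists (Ordinal (ltn_pmod k n0)) => //; exists (g (k %/ n)%N) => //; exists (k %/ n)%N.
  exists (j * n + i)%N => //; rewrite /f divnMDl// divn_small// addn0.
  by congr (`|g j (X _ w)|%:E); apply/val_inj; rewrite /= modnMDl modn_small.
apply: measurable_fun_esups => k; apply/measurable_EFinP.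
by apply: measurableT_comp => //; exact: measurableT_comp (mg _) (mX _).
Qed.

(** The envelope is the supremum of the empty set, and the absolute value of
-oo is +oo. *)
Lemma Lnorm_envelope_empty (P : probability T R) (F : set (U -> R)) (q : R) :
  0 < q -> n = 0%N \/ F = set0 -> ('N[P]_(q%:E)[envelope F X] = +oo)%E.
Proof.
move=> q0 nF; have -> : envelope F X = cst -oo%E.
  apply/funext => w; rewrite /envelope -[RHS](@ereal_sup0 R); congr ereal_sup.
  rewrite -subset0 => y [i _ [f Ff _]].
  case: nF => [nE|F0]; last by move: Ff; rewrite F0.
  by have := ltn_ord i; rewrite [X in (_ < X)%N]nE.
rewrite unlock /Lnorm (eq_integral (cst +oo%E)); last by move=> w _; rewrite poweRyr ?gt_eqF.
have -> : (\int[P]_w cst +oo w = +oo * P setT)%E by exact: integral_cst.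
by rewrite probability_setT mule1 poweRyr// gt_eqF ?invr_gt0.
Qed.

End envelope_theory.

Lemma countable_range (T : Type) (A : set T) : countable A -> A !=set0 ->
  exists g : nat -> T, range g = A.
Proof.
move=> cA A0; have /pfcard_geP[AE|[g]] := cA.
  by move: A0; rewrite AE => -[].
exists g; apply: surj_image_eq; first by move=> _ [j _ <-]; exact: funS.
exact: surj.
Qed.

Theorem theorem13 (R : realType) :
  exists C2 : R, 0 <= C2 < 242 / 100 /\
  forall (dT dU : measure_display) (T : measurableType dT)
    (U : measurableType dU) (P : probability T R) (n : nat)
    (F : set (U -> R)) (X : 'I_n -> {RV P >-> U}) (eps : 'I_n -> {RV P >-> R})
    (Z : T -> \bar R) (q : R),
  countable F ->
  (forall f, F f -> measurable_fun [set: U] f) ->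
  independent_RVs X ->
  independent_RVs eps ->
  (forall i, rademacher (eps i)) ->
  independent_pair P (sigma_RVs eps) (sigma_RVs X) ->
  is_cond_expectation P (sigma_RVs X) (rademacher_sup F eps X) Z ->
  2 <= q ->
  let EZ := (\int[P]_w Z w)%E in
  let Mq := ('N[P]_(q%:E)[envelope F X])%E in
  ('N[P]_(q%:E)[(fun w => Z w - EZ)^\+] <=
     sqrte ((2 * kappa R * q)%:E * Mq * EZ) + (kappa R * q)%:E * Mq)%E /\
  ('N[P]_(q%:E)[(fun w => Z w - EZ)^\-] <=
     (Num.sqrt (2 * C2))%:E *
       (sqrte (q%:E * Mq * EZ) + (2 * q)%:E * Mq))%E.
Proof.
exists 2; split; first by apply/andP; split; lra.
move=> dT dU T U P n F X eps Z q cF mF indX indE radE indEX [ZX intZ] q2 EZ Mq.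
have q0 : 0 < q by exact: lt_le_trans q2.
have k0 : 0 < kappa R * q := mulr_gt0 (@kappa_gt0 R) q0.
have -> : Num.sqrt (2 * 2) = 2 :> R by rewrite -expr2 sqrtr_sqr ger0_norm.
(* With an infinite norm both right-hand sides are +oo. *)
have [MqE|Mqfin] := eqVneq Mq +oo%E.
  have yE (y : \bar R) (c : R) : 0 < c -> (sqrte y + c%:E * +oo = +oo)%E.
    move=> c0; rewrite gt0_muley ?lte_fin// addey//.
    by apply: contraTneq (sqrte_ge0 y) => ->.
  rewrite MqE yE// yE; last by rewrite mulr_gt0.
  by split; [exact: leey|rewrite gt0_muley ?lte_fin//; exact: leey].
have [n0 F0] : (0 < n)%N /\ F !=set0.
  split; [rewrite lt0n; apply/eqP|apply/set0P/eqP] => e; move/eqP: Mqfin; apply.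
    by apply: Lnorm_envelope_empty => //; left.
  by apply: Lnorm_envelope_empty => //; right.
have [g gF] := countable_range cF F0.
have mg j : measurable_fun setT (g j) by apply: mF; rewrite -gF; exists j.
have mX i : measurable_fun setT (X i) by exact: measurable_funP.
pose M := envelope F X.
have mM : measurable_fun setT M by rewrite /M -gF; exact: measurable_envelope.
have M0 w : (0 <= M w)%E by exact: envelope_ge0.
have gM w i j : (`|g j (X i w)|%:E <= M w)%E.
  by apply: (@le_envelope _ _ _ _ _ _ X); rewrite -gF; exists j.
have Mq0 : (0 <= Mq)%E by exact: Lnorm_ge0.
pose a := fine Mq; have a0 : 0 <= a by exact: fine_ge0.
have Mqa : Mq = a%:E by rewrite /a fineK// ge0_fin_numE// ltey.
have Ma : (\int[P]_w (M w `^ q) <= (a `^ q)%:E)%E.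
  rewrite -poweR_EFin -Mqa poweR_Lnorm ?lt0r_neq0//.
  rewrite le_eqVlt; apply/orP; left; apply/eqP; apply: eq_integral => w _.
  by rewrite -[envelope _ _ _]/(M w) gee0_abs.
have sX := sigma_RVs_sigma_algebra X.
have iV := integrable_cond_rad mg indX mM M0 gM q2 Ma.
have ZV : ae_eq P setT (fun w => cond_rad g (fun i => X i w)) Z.
  apply: (sub_sigma_ae_eq sX (@sigma_RVs_measurable _ _ _ _ _ P n X)) => //.
    by move=> B mB; exact: cond_rad_sigma.
  move=> A AX; rewrite -(integral_cond_rad mg indE radE indEX AX) gF.
  by rewrite intZ.
have mZ : measurable_fun setT Z.
  by move=> _ B mB; rewrite setTI; apply: (@sigma_RVs_measurable _ _ _ _ _ P n X); exact: ZX.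
have EZE : EZ = (fine (\int[P]_w cond_rad g (fun i => X i w)))%:E.
  rewrite fineK ?integrable_fin_num//; apply/esym/ae_eq_integral => //.
  by case/integrableP : iV.
split.
  apply: le_trans (upper_moment_limit mg indX mM M0 gM q2 a0 Ma mZ ZV) _.
  rewrite mul1r Mqa EZE -!EFinM -EFinD lee_fin lerD2r; apply: ler_wsqrtr.
  set z := fine _; have z0 : 0 <= z.
    by apply: fine_ge0; apply: integral_ge0 => w _; exact: cond_rad_ge0.
  apply: ler_wpM2r => //; apply: ler_wpM2r => //; apply: ler_wpM2r; first exact: ltW.
  by rewrite ler_peMl ?(ltW (@kappa_gt0 R))// ler1n.
apply: le_trans (lower_moment_limit mg indX mM M0 gM q2 a0 Ma mZ ZV) _.
by rewrite Mqa EZE.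
Qed.
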